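(* Let $H\in C^2(\mathbb{T}^n\times\mathbb{R}^n)$ satisfy (H1) and (H2), and assume the ergodic constant of $H$ is $0$. Let $w_1,w_2\in C(\mathbb{T}^n)$ be two viscosity solutions of $$H(x,Dw)=0\quad\text{in }\mathbb{T}^n.$$ Assume that $$\iint_{\mathbb{T}^n\times\mathbb{R}^n} w_1(x)\,d\mu(x,v)\le \iint_{\mathbb{T}^n\times\mathbb{R}^n} w_2(x)\,d\mu(x,v)\qquad\text{for all }\mu\in\widetilde{\mathcal{M}}.$$ Then $w_1\le w_2$ on $\mathbb{T}^n$.
   Context: $\mathbb{T}^n$ is the $n$-dimensional flat torus. Assumptions on $H\in C^2(\mathbb{T}^n\times\mathbb{R}^n)$: (H1) for every $x\in\mathbb{T}^n$, $p\mapsto H(x,p)$ is convex; (H2) uniformly in $x\in\mathbb{T}^n$, $\lim_{|p|\to\infty}H(x,p)/|p|=+\infty$ and $\lim_{|p|\to\infty}\big(\tfrac12 H(x,p)^2+D_xH(x,p)\cdot p\big)=+\infty$. The ergodic constant of $H$ is the unique $c\in\mathbb{R}$ such that $H(x,Dw)=c$ in $\mathbb{T}^n$ has a viscosity solution $w\in C(\mathbb{T}^n)$; it is assumed that $c=0$. $L(x,v)=\sup_{p\in\mathbb{R}^n}(p\cdot v-H(x,p))$ is the Legendre transform of $H$. $\mathcal{P}(\mathbb{T}^n\times\mathbb{R}^n)$ denotes Radon probability measures on $\mathbb{T}^n\times\mathbb{R}^n$. The set of holonomic measures is $$\mathcal{F}=\Big\{\mu\in\mathcal{P}(\mathbb{T}^n\times\mathbb{R}^n):\iint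 v\cdot D\phi(x)\,d\mu(x,v)=0\ \text{for all }\phi\in C^1(\mathbb{T}^n)\Big\}.$$ The set of Mather measures $\widetilde{\mathcal{M}}\subset\mathcal{F}$ is the set of minimizers of $\mu\mapsto\iint L(x,v)\,d\mu(x,v)$ over $\mathcal{F}$ (under $c=0$ this minimum equals $0$). *)

(* Defs.v *)
From mathcomp Require Import all_boot all_order all_algebra.
From mathcomp Require Import all_classical all_reals all_analysis.
Import Order.TTheory GRing.Theory Num.Theory.
Import numFieldNormedType.Exports.

Set Implicit Arguments.
Unset Strict Implicit.
Unset Printing Implicit Defensive.

Local Open Scope classical_set_scope.
Local Open Scope ring_scope.

(* The torus T^n = R^n / Z^n is represented through Z^n-periodic objects on
   R^n = 'rV[R]_n; (T^n x R^n) measures are represented by Borel probability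
   measures on R^n x R^n concentrated on [0,1)^n x R^n. *)

Section Defs.
Variables (R : realType) (n : nat).

Definition unitv (i : 'I_n) : 'rV[R]_n := delta_mx 0 i.

Definition dotv (p v : 'rV[R]_n) : R := \sum_(i < n) p 0 i * v 0 i.

Definition periodic {T : Type} (f : 'rV[R]_n -> T) :=
  forall x (i : 'I_n), f (x + unitv i) = f x.

Definition periodicH (H : 'rV[R]_n -> 'rV[R]_n -> R) :=
  forall p, periodic (fun x => H x p).

Definition grad (f : 'rV[R]_n -> R) (x : 'rV[R]_n) : 'rV[R]_n :=
  \row_i ('D_(unitv i) f x).

End Defs.

Definition isC1 (R : realType) (V : normedModType R) (f : V -> R) :=
  continuous f /\
  forall v : V, (forall x, derivable f x v) /\ continuous ('D_v f).

Definition isC2 (R : realType) (V : normedModType R) (f : V -> R) :=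
  isC1 f /\ forall v : V, isC1 ('D_v f).

Section Defs2.
Variables (R : realType) (n : nat).

Definition C2_Ham (H : 'rV[R]_n -> 'rV[R]_n -> R) :=
  isC2 (fun z : 'rV[R]_n * 'rV[R]_n => H z.1 z.2).

Definition H1 (H : 'rV[R]_n -> 'rV[R]_n -> R) :=
  forall x p q (t : R), 0 <= t <= 1 ->
    H x (t *: p + (1 - t) *: q) <= t * H x p + (1 - t) * H x q.

Definition H2a (H : 'rV[R]_n -> 'rV[R]_n -> R) :=
  forall M : R, exists K : R, forall x p, K <= `|p| -> M <= H x p / `|p|.

Definition H2b (H : 'rV[R]_n -> 'rV[R]_n -> R) :=
  forall M : R, exists K : R, forall x p, K <= `|p| ->
    M <= H x p ^+ 2 / 2 + 'D_p (fun y => H y p) x.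

Definition visc_sub (H : 'rV[R]_n -> 'rV[R]_n -> R) (c : R) (w : 'rV[R]_n -> R) :=
  forall (x0 : 'rV[R]_n) (phi : 'rV[R]_n -> R), isC1 phi ->
    (\forall y \near x0, w y - phi y <= w x0 - phi x0) ->
    H x0 (grad phi x0) <= c.

Definition visc_super (H : 'rV[R]_n -> 'rV[R]_n -> R) (c : R) (w : 'rV[R]_n -> R) :=
  forall (x0 : 'rV[R]_n) (phi : 'rV[R]_n -> R), isC1 phi ->
    (\forall y \near x0, w x0 - phi x0 <= w y - phi y) ->
    c <= H x0 (grad phi x0).

Definition visc_sol (H : 'rV[R]_n -> 'rV[R]_n -> R) (c : R) (w : 'rV[R]_n -> R) :=
  [/\ continuous w, periodic w, visc_sub H c w & visc_super H c w].

Definition is_ergodic_constant (H : 'rV[R]_n -> 'rV[R]_n -> R) (c : R) :=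
  (exists w, visc_sol H c w) /\
  (forall c', (exists w, visc_sol H c' w) -> c' = c).

Definition phase_open := [set A : set ('rV[R]_n * 'rV[R]_n) | open A].
Definition phase := g_sigma_algebraType phase_open.

Definition Lagr (H : 'rV[R]_n -> 'rV[R]_n -> R) (x v : 'rV[R]_n) : \bar R :=
  ereal_sup [set ((dotv p v - H x p)%:E) | p in [set: 'rV[R]_n]].

(* mu is concentrated on the fundamental domain [0,1)^n x R^n, i.e. it
   represents a probability measure on T^n x R^n *)
Definition torus_supported (mu : probability phase R) :=
  mu [set z : phase | forall i : 'I_n, 0 <= z.1 0 i < 1] = 1%E.

Definition holonomic (mu : probability phase R) :=
  torus_supported mu /\
  forall phi : 'rV[R]_n -> R, isC1 phi -> periodic phi ->
    mu.-integrable [set: phase] (fun z : phase => (dotv z.2 (grad phi z.1))%:E) /\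
    (\int[mu]_(z in [set: phase]) (dotv z.2 (grad phi z.1))%:E = 0)%E.

Definition action (H : 'rV[R]_n -> 'rV[R]_n -> R) (mu : probability phase R) : \bar R :=
  (\int[mu]_(z in [set: phase]) Lagr H z.1 z.2)%E.

Definition mather (H : 'rV[R]_n -> 'rV[R]_n -> R) (mu : probability phase R) :=
  holonomic mu /\
  forall nu : probability phase R, holonomic nu -> (action H mu <= action H nu)%E.

End Defs2.

(* Main.v *)
(* Let M be the maximum of w1 - w2, attained at xM; it suffices to find a Mather measure mu with
   \int (w1 - w2) dmu >= M.

   Parametrize velocities by momenta, v = D_pH(x,p), so that L(x,v) = p.v - H(x,p), and put
   g = w1 - w2 - M.  On a compact set K = [0,1]^n x {|p| <= P} consider
     q(f) = inf_(phi, a >= 0, b >= 0) sup_K (f - D_pH.Dphi - a L + b g).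
   A linear functional below the sublinear functional q is, by the Riesz representation theorem,
   integration against a probability measure which is holonomic, has action <= 0 and satisfies
   \int g >= 0.  Its push-forward to the torus is a Mather measure because every holonomic
   measure has nonnegative action.

   Both that nonnegativity and the bound q(0) >= 0, which makes q finite, rest on C^1 approximate
   subsolutions: the average psi of w1 over a small box is C^1 and satisfies H(x, Dpsi) <= delta.
   If q(0) < 0, then u = (1 - t a) psi - t phi touches w2 from below, up to a constant, at a point
   where the viscosity supersolution inequality fails. *)
From HB Require Import structures.
Require Import Defs.
From mathcomp Require Import all_boot all_order all_algebra.
From mathcomp Require Import all_classical all_reals all_analysis.
From mathcomp Require Import measurable_realfun ring lra.
Import Order.TTheory GRing.Theory Num.Theory.
Import numFieldNormedType.Exports.
Local Open Scope classical_set_scope.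
Local Open Scope ring_scope.

Set Implicit Arguments.
Unset Strict Implicit.
Unset Printing Implicit Defensive.

(* [periodic] is otherwise shadowed by the notion of trigo.v. *)
Local Notation periodic := Defs.periodic.

(** Two obstacles shape the argument. Velocities range over a noncompact space and L may be +oo
    there, so mass could escape to infinity; over a compact set of momenta the Lagrangian p.v -
    H(x,p), with v = D_pH(x,p), is finite and continuous, and the radius P only has to contain the
    gradients of the perturbed subsolution u. Moreover, a viscosity solution has no gradient to be
    averaged. Increments along a short segment in one direction v are used instead: a bound on q.v
    valid for all test gradients q integrates to a bound on the increment, and such bounds pass to
    averages. The direction is v = D_pH(x, Dpsi(x)), for which convexity separates Dpsi(x) from the
    sublevel set of H whenever H(x, Dpsi(x)) is too large. The multipliers a and b place the
    inequalities on the action and on g in the same dual problem as holonomy. The factor 1 - t a in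
    u is what absorbs the term a L: the combination collapses to (1 - t a)(Du - Dpsi).v + t a
    H(y,Du), bounded below by convexity and by the supersolution inequality. *)

(** * The Hahn-Banach theorem for sublinear functionals on a subspace *)

Section HahnBanach.
Context {R : realType} {V : lmodType R}.
Variable D : set V.
Hypothesis D0 : D 0.
Hypothesis DD : forall f g, D f -> D g -> D (f + g).
Hypothesis DZ : forall (t : R) f, D f -> D (t *: f).

(** Homogeneity is stated as an inequality, which infima preserve directly; the inverse scalar gives
    back equality. Everything is relative to D because V will be the space of all functions and D
    that of the continuous ones. *)
Definition sublinear_on (p : V -> R) :=
  (forall f g, D f -> D g -> p (f + g) <= p f + p g) /\
  (forall t f, 0 < t -> D f -> p (t *: f) <= t * p f).

Lemma sublinear_on0 p : sublinear_on p -> p 0 = 0.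
Proof.
move=> [_ pZ]; have p2 : 0 < 2 :> R by [].
have := pZ 2 0 p2 D0; have := pZ 2^-1 0 _ D0.
by rewrite !scaler0 invr_gt0 p2 => /(_ isT); lra.
Qed.

Lemma sublinear_onN p f : sublinear_on p -> D f -> - p (- f) <= p f.
Proof.
move=> pS Df; have := pS.1 f (- f) Df; rewrite subrr (sublinear_on0 pS) -scaleN1r.
by move=> /(_ (DZ _ Df)); lra.
Qed.

(* A pointwise minimal sublinear functional is linear: for each a, the sublinear functional
   f |-> inf_(t >= 0) q (f + t a) - t q a lies below q and is at most - q a at - a. *)
Lemma minimal_sublinear_odd q : sublinear_on q ->
  (forall q', sublinear_on q' -> (forall f, D f -> q' f <= q f) ->
     forall f, D f -> q f <= q' f) ->
  forall a, D a -> q (- a) = - q a.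
Proof.
move=> qS qmin a Da.
pose E f := [set q (f + t *: a) - t * q a | t in [set t : R | 0 <= t]].
have E0 f : E f (q f) by exists 0 => //=; rewrite scale0r mul0r addr0 subr0.
have Elb f : D f -> lbound (E f) (- q (- f)).
  move=> Df _ [t /= t0 <-].
  have : t * q a <= q (f + t *: a) + q (- f).
    have [->|tn0] := eqVneq t 0.
      by rewrite scale0r mul0r addr0; have := sublinear_onN qS Df; lra.
    have tp : 0 < t by rewrite lt_neqAle eq_sym tn0.
    have tVp : 0 < t^-1 by rewrite invr_gt0.
    have h1 := qS.2 _ (t *: a) tVp (DZ t Da).
    rewrite scalerA mulVf // scale1r in h1.
    have h2 : t * q a <= q (t *: a).
      by rewrite -(ler_pM2l tVp) mulrA mulVf // mul1r.
    apply: le_trans h2 _.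
    have := qS.1 (f + t *: a) (- f); rewrite (addrC f) addrK; apply.
      by apply: DD => //; apply: DZ.
    by rewrite -scaleN1r; apply: DZ.
  by lra.
have Einf f : D f -> has_inf (E f).
  by move=> Df; split; [exists (q f)|exists (- q (- f)); apply: Elb].
pose q' f := inf (E f).
have q'le f t : D f -> 0 <= t -> q' f <= q (f + t *: a) - t * q a.
  by move=> Df t0; apply: ge_inf; [exists (- q (- f)); apply: Elb|exists t].
have q'S : sublinear_on q'.
  split=> [f g Df Dg|t f t0 Df].
    apply/ler_addgt0Pl => e e0; have e20 : 0 < e / 2 by rewrite divr_gt0.
    have [_ [s /= s0 <-] hs] := inf_adherent e20 (Einf f Df).
    have [_ [t /= t0 <-] ht] := inf_adherent e20 (Einf g Dg).
    have /= := q'le (f + g) (s + t) (DD Df Dg) (addr_ge0 s0 t0).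
    have := qS.1 (f + s *: a) (g + t *: a) (DD Df (DZ s Da)) (DD Dg (DZ t Da)).
    rewrite scalerDl addrACA /q' mulrDl; lra.
  rewrite -ler_pdivrMl //; apply: lb_le_inf; first by exists (q f).
  move=> _ [s /= s0 <-]; rewrite ler_pdivrMl //.
  have /= := q'le (t *: f) (t * s) (DZ t Df) (mulr_ge0 (ltW t0) s0).
  have := qS.2 t (f + s *: a) t0 (DD Df (DZ s Da)).
  by rewrite scalerDr scalerA; lra.
have DNa : D (- a) by rewrite -scaleN1r; apply: DZ.
have := qmin q' q'S _ (- a) DNa.
have := q'le (- a) 1 DNa ler01; rewrite scale1r addNr (sublinear_on0 qS) mul1r.
have := sublinear_onN qS Da.
move=> h1 h2 h3; apply/eqP; rewrite eq_le; apply/andP; split; last by lra.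
apply: le_trans (h3 _) _; last by lra.
by move=> f Df; have := q'le f 0 Df (lexx 0); rewrite scale0r addr0 mul0r subr0.
Qed.

(** Zorn's lemma for the reversed pointwise order, only a preorder since values off D are not
    compared. A chain is bounded by its pointwise infimum, finite because every member at f is at
    least - p (- f); totality of the chain lets one member serve both summands in subadditivity. *)
Lemma exists_minimal_sublinear p : sublinear_on p ->
  exists2 q, sublinear_on q & (forall f, D f -> q f <= p f) /\
  (forall q', sublinear_on q' -> (forall f, D f -> q' f <= q f) ->
     forall f, D f -> q f <= q' f).
Proof.
move=> pS.
pose T := {q : V -> R | sublinear_on q /\ forall f, D f -> q f <= p f}.
pose le (s t : T) := `[< forall f, D f -> sval t f <= sval s f >].
pose t0 : T := exist _ p (conj pS (fun f _ => lexx (p f))).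
have [||A Atot|[q [qS qp]] qmin] := @ZL_preorder T t0 le.
- by move=> t; apply/asboolP => f _.
- move=> r s t /asboolP rs /asboolP st; apply/asboolP => f Df.
  exact: le_trans (st f Df) (rs f Df).
- have [[s0 As0]|/asboolPn] := pselect (exists s, A s); last first.
    move=> /asboolPn A0; exists t0 => s As; exfalso; apply: A0; by exists s.
  pose E f := [set sval s f | s in A].
  have Elb f : D f -> lbound (E f) (- p (- f)).
    move=> Df _ [[s [sS sp]] _ <-] /=.
    apply: le_trans (sublinear_onN sS Df); rewrite lerN2; apply: sp.
    by rewrite -scaleN1r; apply: DZ.
  have Einf f : D f -> has_inf (E f).
    by move=> Df; split; [exists (sval s0 f); exists s0|exists (- p (- f)); apply: Elb].
  pose q f := inf (E f).
  have qle f s : D f -> A s -> q f <= sval s f.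
    by move=> Df As; apply: ge_inf; [exists (- p (- f)); apply: Elb|exists s].
  have qS : sublinear_on q.
    split=> [f g Df Dg|t f t_gt0 Df].
      apply/ler_addgt0Pl => e e0; have e20 : 0 < e / 2 by rewrite divr_gt0.
      have [_ [s As <-] hs] := inf_adherent e20 (Einf f Df).
      have [_ [t At <-] ht] := inf_adherent e20 (Einf g Dg).
      have [/asboolP st|/asboolP st] := Atot s t As At.
        have := qle _ t (DD Df Dg) At; have := (svalP t).1.1 f g Df Dg.
        have := st f Df; rewrite /q; lra.
      have := qle _ s (DD Df Dg) As; have := (svalP s).1.1 f g Df Dg.
      have := st g Dg; rewrite /q; lra.
    rewrite -ler_pdivrMl //; apply: lb_le_inf; first by exists (sval s0 f); exists s0.
    move=> _ [s As <-]; rewrite ler_pdivrMl //.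
    by apply: le_trans (qle _ s (DZ t Df) As) _; apply: (svalP s).1.2.
  have qp f : D f -> q f <= p f.
    by move=> Df; apply: le_trans (qle f s0 Df As0) _; apply: (svalP s0).2.
  exists (exist _ q (conj qS qp)) => s As; apply/asboolP => f Df /=.
  exact: qle.
exists q => //; split=> // q' q'S q'q f Df.
have q'p f' : D f' -> q' f' <= p f'.
  by move=> Df'; apply: le_trans (q'q _ Df') (qp _ Df').
have /asboolP := qmin (exist _ q' (conj q'S q'p)) (introT (asboolP _) q'q).
by apply.
Qed.

(** A minimal sublinear functional below p is odd, and oddness turns the sublinear inequalities,
    applied to opposite vectors, into equalities. *)
Lemma hahn_banach p : sublinear_on p ->
  exists L : V -> R,
  [/\ forall f g, D f -> D g -> L (f + g) = L f + L g,
      forall t f, D f -> L (t *: f) = t * L f &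
      forall f, D f -> L f <= p f].
Proof.
move=> pS; have [q qS [qp qmin]] := exists_minimal_sublinear pS.
have qN := minimal_sublinear_odd qS qmin.
have DN f : D f -> D (- f) by move=> Df; rewrite -scaleN1r; apply: DZ.
have qZ t f : 0 < t -> D f -> q (t *: f) = t * q f.
  move=> t0 Df; apply/eqP; rewrite eq_le qS.2 //=.
  have := qS.2 t (- f) t0 (DN _ Df); rewrite scalerN !qN ?mulrN ?lerN2 //.
  exact: DZ.
exists q; split=> // [f g Df Dg|t f Df].
  apply/eqP; rewrite eq_le qS.1 //=.
  have := qS.1 _ _ (DN _ Df) (DN _ Dg); rewrite -opprD !qN //; last exact: DD.
  by lra.
have [t0|t0|->] := ltgtP t 0; last by rewrite scale0r mul0r sublinear_on0.
  rewrite -[t]opprK scaleNr qN; last exact: DZ.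
  by rewrite qZ ?mulNr // oppr_gt0.
exact: qZ.
Qed.

End HahnBanach.

(** * Continuity of pointwise operations *)

Section ContinuousLambda.
Context {R : realType} {T : topologicalType}.
Implicit Types f g : T -> R.

Lemma cont_cst (c : R) : continuous (fun _ : T => c).
Proof. exact: cst_continuous. Qed.

Lemma cont_add f g : continuous f -> continuous g -> continuous (fun x => f x + g x).
Proof. by move=> cf cg x; apply: (@continuousD _ _ _ f g x (cf x) (cg x)). Qed.

Lemma cont_sub f g : continuous f -> continuous g -> continuous (fun x => f x - g x).
Proof. by move=> cf cg x; apply: (@continuousB _ _ _ f g x (cf x) (cg x)). Qed.

Lemma cont_opp f : continuous f -> continuous (fun x => - f x).
Proof. by move=> cf x; apply: (@continuousN _ _ _ f x (cf x)). Qed.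

Lemma cont_mul f g : continuous f -> continuous g -> continuous (fun x => f x * g x).
Proof. by move=> cf cg x; apply: (@continuousM _ _ f g x (cf x) (cg x)). Qed.

Lemma cont_max f g : continuous f -> continuous g -> continuous (fun x => Num.max (f x) (g x)).
Proof. by move=> cf cg x t; apply: (@continuous_max _ _ f g x (cf x) (cg x)). Qed.

Lemma cont_min f g : continuous f -> continuous g -> continuous (fun x => Num.min (f x) (g x)).
Proof. by move=> cf cg x t; apply: (@continuous_min _ _ f g x (cf x) (cg x)). Qed.

Lemma cont_abs f : continuous f -> continuous (fun x => `|f x|).
Proof.
move=> cf x; apply: (@continuous_comp _ _ _ f (fun y : R => `|y|) x (cf x)).
exact: norm_continuous.
Qed.

Lemma cont_sum (I : Type) (s : seq I) (F : I -> T -> R) :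
  (forall i, continuous (F i)) -> continuous (fun x => \sum_(i <- s) F i x).
Proof.
move=> cF; elim: s => [|i s IH].
  by under eq_fun do rewrite big_nil; exact: cont_cst.
by under eq_fun do rewrite big_cons; exact: cont_add.
Qed.

End ContinuousLambda.

Lemma cont_comp (T U W : topologicalType) (f : T -> U) (g : U -> W) :
  continuous f -> continuous g -> continuous (fun x => g (f x)).
Proof. by move=> cf cg x; apply: (continuous_comp (cf x) (cg (f x))). Qed.

(** * Clamping, double series, distance functions and cutoffs *)

Section Clamp.
Context {R : realType}.

Definition clamp01 (y : R) : R := Num.max 0 (Num.min y 1).

Lemma clamp01_ge0 y : 0 <= clamp01 y.
Proof. by rewrite /clamp01 le_max lexx. Qed.

Lemma clamp01_le1 y : clamp01 y <= 1.
Proof. by rewrite /clamp01 ge_max ler01 ge_min lexx orbT. Qed.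

Lemma clamp01_le0 y : y <= 0 -> clamp01 y = 0.
Proof. by move=> y0; apply/max_idPl; rewrite ge_min y0. Qed.

Lemma clamp01_ge1 y : 1 <= y -> clamp01 y = 1.
Proof. by move=> y1; rewrite /clamp01 (min_idPr y1); apply/max_idPr. Qed.

Lemma clamp01_id y : 0 <= y <= 1 -> clamp01 y = y.
Proof. by move=> /andP[y0 y1]; rewrite /clamp01 (min_idPl y1); apply/max_idPr. Qed.

Lemma clamp01_homo : {homo clamp01 : x y / x <= y}.
Proof. by move=> x y xy; rewrite /clamp01 ge_max !le_max lexx /= le_min !ge_min xy lexx /= !orbT. Qed.

Lemma continuous_clamp01 (T : topologicalType) (f : T -> R) :
  continuous f -> continuous (fun x => clamp01 (f x)).
Proof.
by move=> cf; apply: cont_max; [exact: cont_cst|apply: cont_min => //; exact: cont_cst].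
Qed.

Lemma sum_clamp01 (N : nat) (y : R) : 0 <= y ->
  \sum_(j < N) clamp01 (y - j%:R) = Num.min y N%:R.
Proof.
move=> y0; elim: N => [|N IH]; first by rewrite big_ord0; apply/esym/min_idPr.
rewrite big_ord_recr /= IH; have [yN|Ny] := leP y N%:R.
  rewrite clamp01_le0 ?addr0; last by rewrite subr_le0.
  by apply/esym/min_idPl; rewrite (le_trans yN) // ler_nat.
have [yN|{}yN] := leP y N.+1%:R; rewrite -natr1 in yN *.
  by rewrite clamp01_id; [lra|apply/andP; split; lra].
by rewrite clamp01_ge1; lra.
Qed.

End Clamp.

Lemma exists_nat_pair : exists p : nat -> nat * nat, bijective p.
Proof.
have /card_esym/ppcard_eqP[f] := card_nat2.
by exists f; exact: bijTT.
Qed.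

(** Countably many sequences of functions are merged into a single one, the form that [upper_family]
    requires. *)
Lemma nneseries_nat_pair {R : realType} (p : nat -> nat * nat) (a : nat -> nat -> \bar R) :
  bijective p -> (forall i j, 0 <= a i j)%E ->
  (\sum_(k <oo) a (p k).1 (p k).2 = \sum_(i <oo) \sum_(j <oo) a i j)%E.
Proof.
move=> pb a0.
rewrite nneseries_esumT; last by move=> k; exact: a0.
rewrite nneseries_esumT; last by move=> i; apply: nneseries_ge0.
transitivity (\esum_(i in [set: nat]) \esum_(j in [set: nat]) a i j)%E; last first.
  by apply: eq_esum => i _; rewrite nneseries_esumT.
rewrite (esum_esum (J := fun _ => setT)) //.
rewrite -(@reindex_esum _ _ _ setT ([set: nat] `*`` (fun _ => setT)) p (fun k => a k.1 k.2)) //.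
have [q pK qK] := pb.
by split => //; [move=> x y _ _; exact: (can_inj pK)|move=> k _; exists (q k)].
Qed.

Section SetDistance.
Context {R : realType} {V : normedModType R}.
Variable C : set V.

Definition set_dist (x : V) : R := inf [set `|x - y| | y in C].

Lemma set_dist_ge0 x : 0 <= set_dist x.
Proof.
have [C0|/set0P C0] := eqVneq C set0; first by rewrite /set_dist C0 image_set0 inf0.
by apply: lb_le_inf; [exact: image_nonempty|move=> _ [y _ <-]].
Qed.

Lemma set_dist_le x y : C y -> set_dist x <= `|x - y|.
Proof. by move=> Cy; apply: ge_inf; [exists 0 => _ [z _ <-]|exists y]. Qed.

Lemma set_dist0 x : C x -> set_dist x = 0.
Proof.
move=> Cx; apply/eqP; rewrite eq_le set_dist_ge0 andbT.
by apply: le_trans (set_dist_le x Cx) _; rewrite subrr normr0.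
Qed.

Lemma set_dist_lip x y : `|set_dist x - set_dist y| <= `|x - y|.
Proof.
wlog suff h : x y / set_dist x - set_dist y <= `|x - y|.
  by rewrite ler_norml h andbT lerNl opprB distrC h.
have [C0|/set0P C0] := eqVneq C set0.
  by rewrite /set_dist C0 !image_set0 inf0 subrr.
rewrite lerBlDl -lerBlDr; apply: lb_le_inf; first exact: image_nonempty.
move=> _ [z Cz <-]; rewrite lerBlDr; apply: le_trans (set_dist_le x Cz) _.
by rewrite -[x - z](subrKA y) addrC ler_normD.
Qed.

Lemma lipschitz_cont (U : normedModType R) (f : U -> R) (k : R) :
  (forall x y, `|f x - f y| <= k * `|x - y|) -> continuous f.
Proof.
move=> fk x; apply/cvgrPdist_le => e e0.
have k0 : 0 < `|k| + 1 by rewrite ltr_wpDl.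
near=> y; apply: le_trans (fk x y) _.
apply: (@le_trans _ _ ((`|k| + 1) * `|x - y|)).
  by rewrite ler_wpM2r // (le_trans (ler_norm k)) // lerDl.
rewrite -ler_pdivlMl //; near: y; apply: cvgr_dist_le; last by rewrite mulr_gt0 // invr_gt0.
exact: cvg_id.
Unshelve. all: by end_near. Qed.

Lemma continuous_set_dist : continuous set_dist.
Proof. by apply: (@lipschitz_cont _ _ 1) => x y; rewrite mul1r; exact: set_dist_lip. Qed.

Lemma set_dist_gt0 x : closed C -> C !=set0 -> ~ C x -> 0 < set_dist x.
Proof.
move=> Cc C0 Cx; have /nbhs_ballP[e /= e0 eC] : nbhs x (~` C).
  by apply: open_nbhs_nbhs; split => //; rewrite openC.
apply: lt_le_trans e0 _; apply: lb_le_inf; first exact: image_nonempty.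
move=> _ [y Cy <-]; rewrite leNgt; apply/negP => xy.
by apply: (eC y) => //; rewrite -ball_normE.
Qed.

End SetDistance.

(** Starting from phi_0 = 0 makes the increments phi_(k+1) - phi_k telescope to phi_n, and at each
    point of U the value 1 is reached after finitely many steps. *)
Lemma open_cutoffs {R : realType} {V : normedModType R} (U : set V) : open U ->
  exists phi : nat -> V -> R, [/\ forall k, continuous (phi k),
    forall x, phi 0%N x = 0,
    forall k x, 0 <= phi k x <= phi k.+1 x /\ phi k.+1 x <= 1,
    forall k x, ~ U x -> phi k x = 0 &
    forall x, U x -> exists k, phi k x = 1].
Proof.
(* The distance to the empty set is 0 by convention, which would make every cutoff vanish when U is
   the whole space; this case gets constant cutoffs. *)
move=> oU; have [C0|/set0P C0] := eqVneq (~` U) set0.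
  exists (fun k x => (k != 0%N)%:R); split => //.
  - by move=> k; exact: cont_cst.
  - by move=> [|k] x; rewrite /= ?lexx ?ler01.
  - by move=> k x nU; have : (~` U) x by []; rewrite C0.
  - by exists 1%N.
exists (fun k x => clamp01 (k%:R * set_dist (~` U) x)); split => //.
- move=> k; apply: continuous_clamp01; apply: cont_mul; first exact: cont_cst.
  exact: continuous_set_dist.
- by move=> x; rewrite mul0r clamp01_le0.
- move=> k x; rewrite clamp01_ge0 clamp01_le1; split => //=.
  by apply: clamp01_homo; rewrite ler_wpM2r ?set_dist_ge0 // ler_nat.
- by move=> k x nU; rewrite set_dist0 // mulr0 clamp01_le0.
move=> x Ux; have d0 : 0 < set_dist (~` U) x.
  by apply: set_dist_gt0 => //; rewrite closedC.
exists (Num.Def.archi_bound (set_dist (~` U) x)^-1); apply: clamp01_ge1.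
rewrite -ler_pdivrMr // mul1r ltW // archi_boundP // invr_ge0 ltW //.
Qed.

(** * The outer measure of a positive functional *)

Section Riesz.
Context {R : realType} {V : normedModType R}.
Variables (K : set V) (Lam : (V -> R) -> R).
Hypothesis Kc : compact K.
Hypothesis LamD : forall f g : V -> R, continuous f -> continuous g ->
  Lam (fun x => f x + g x) = Lam f + Lam g.
Hypothesis LamZ : forall (t : R) (f : V -> R), continuous f -> Lam (fun x => t * f x) = t * Lam f.
(** This single bound encodes positivity, the normalization Lam 1 = 1 and the indifference of Lam to
    values off K. *)
Hypothesis Lam_le : forall (f : V -> R) (c : R), continuous f -> (forall x, K x -> f x <= c) -> Lam f <= c.

Lemma Lam_ge (f : V -> R) (c : R) : continuous f -> (forall x, K x -> c <= f x) -> c <= Lam f.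
Proof.
move=> cf fc; have cf' := @cont_opp _ _ f cf.
have -> : f = (fun x => -1 * - f x) by apply/funext => x; rewrite mulN1r opprK.
rewrite LamZ // mulN1r -lerN2 opprK; apply: Lam_le => // x Kx.
by rewrite lerN2; apply: fc.
Qed.

Lemma Lam_mono (f g : V -> R) : continuous f -> continuous g -> (forall x, K x -> f x <= g x) ->
  Lam f <= Lam g.
Proof.
move=> cf cg fg; have cfg := cont_sub cg cf.
have -> : g = (fun x => f x + (g x - f x)) by apply/funext => x; rewrite addrC subrK.
by rewrite LamD // lerDl; apply: Lam_ge => // x Kx; rewrite subr_ge0; apply: fg.
Qed.

Lemma Lam_cst (c : R) : Lam (fun _ => c) = c.
Proof.
have cc : continuous (fun _ : V => c) by exact: cont_cst.
by apply/eqP; rewrite eq_le; apply/andP; split; [apply: Lam_le|apply: Lam_ge].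
Qed.

Lemma Lam_sum n (F : nat -> V -> R) : (forall i, continuous (F i)) ->
  Lam (fun x => \sum_(i < n) F i x) = \sum_(i < n) Lam (F i).
Proof.
move=> cF; elim: n => [|n IH].
  rewrite big_ord0 -[RHS](Lam_cst 0); congr Lam; apply/funext => x; exact: big_ord0.
rewrite big_ord_recr /= -IH -LamD //; last exact: cont_sum.
by congr Lam; apply/funext => x; rewrite big_ord_recr.
Qed.

(** As in Daniell's construction, the indicator of A is dominated by a series of nonnegative
    continuous functions. Using series instead of single functions makes countable subadditivity a
    matter of merging families. *)
Definition upper_family (A : set V) := [set F : nat -> V -> R |
  [/\ forall i, continuous (F i), forall i x, 0 <= F i x &
      forall x, A x -> (1 <= \sum_(i <oo) (F i x)%:E)%E]].

Definition upper_measure (A : set V) : \bar R :=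
  ereal_inf [set (\sum_(i <oo) (Lam (F i))%:E)%E | F in upper_family A].

Lemma Lam_ge0 (f : V -> R) : continuous f -> (forall x, 0 <= f x) -> 0 <= Lam f.
Proof. by move=> cf f0; apply: Lam_ge. Qed.

Lemma upper_measure_ge0 A : (0 <= upper_measure A)%E.
Proof.
apply: le_ereal_inf_tmp => _ [F [cF F0 _] <-]; apply: nneseries_ge0 => i _ _.
by rewrite lee_fin; apply: Lam_ge0.
Qed.

Lemma upper_measure_le A F : upper_family A F ->
  (upper_measure A <= \sum_(i <oo) (Lam (F i))%:E)%E.
Proof. by move=> AF; apply: ereal_inf_lbound; exists F. Qed.

Lemma upper_measure_le_fun A (f : V -> R) : continuous f -> (forall x, 0 <= f x) ->
  (forall x, A x -> 1 <= f x) -> (upper_measure A <= (Lam f)%:E)%E.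
Proof.
move=> cf f0 Af; pose F i x := if i is 0%N then f x else 0 : R.
have s0 (u : nat -> \bar R) : (forall i, 0 <= u i)%E -> (forall i, u i.+1 = 0)%E ->
    (\sum_(i <oo) u i = u 0%N)%E.
  move=> u0 uS; rewrite nneseries_recl // eseries0 ?adde0 //.
  by case=> // i _ _; exact: uS.
have -> : ((Lam f)%:E = \sum_(i <oo) (Lam (F i))%:E)%E.
  rewrite s0 // => i; last by rewrite /F Lam_cst.
  by rewrite lee_fin; apply: Lam_ge0; case: i => // i; exact: cont_cst.
apply: upper_measure_le; split.
- by case=> // i; exact: cont_cst.
- by case.
by move=> x Ax; rewrite s0 ?lee_fin; [exact: Af|case=> //=; rewrite lee_fin|].
Qed.

Lemma upper_measure0 : upper_measure set0 = 0%E.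
Proof.
apply/eqP; rewrite eq_le upper_measure_ge0 andbT -[leRHS]/((0 : R)%:E) -(Lam_cst 0).
by apply: upper_measure_le_fun => //; exact: cont_cst.
Qed.

Lemma upper_measure_homo : {homo upper_measure : A B / A `<=` B >-> (A <= B)%E}.
Proof.
move=> A B AB; apply: le_ereal_inf => _ [F [cF F0 BF] <-]; exists F => //; split=> // x Ax.
by apply: BF; apply: AB.
Qed.

Lemma upper_measure_sigma_subadditive : sigma_subadditive upper_measure.
Proof.
move=> A; have [[i ioo]|] := pselect (exists i, upper_measure (A i) = +oo%E).
  rewrite (eseries_pinfty _ _ ioo) ?leey// => n _.
  by rewrite -ltNye (lt_le_trans _ (upper_measure_ge0 _)).
rewrite -forallNE => Aoo; apply/lee_addgt0Pr => e e0.
apply: le_trans (epsilon_trick xpredT _ (ltW e0)); last by move=> n; exact: upper_measure_ge0.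
have /choice[G GP] : forall n, exists F, upper_family (A n) F /\
    (\sum_(i <oo) (Lam (F i))%:E <= upper_measure (A n) + (e / (2 ^ n.+1)%:R)%:E)%E.
  move=> n; have en : 0 < e / (2 ^ n.+1)%:R by rewrite divr_gt0 // ltr0n expn_gt0.
  have fn : upper_measure (A n) \is a fin_num.
    by rewrite ge0_fin_numE ?upper_measure_ge0 // ltey; apply/eqP/Aoo.
  have [_ [F AF <-] /ltW lF] := lb_ereal_inf_adherent en fn.
  by exists F.
have [p pb] := exists_nat_pair.
pose F k := G (p k).1 (p k).2.
have LG0 i j : (0 <= (Lam (G i j))%:E)%E.
  by have [[cG G0 _] _] := GP i; rewrite lee_fin Lam_ge0.
apply: (@le_trans _ _ (\sum_(k <oo) (Lam (F k))%:E)%E).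
  apply: upper_measure_le; split.
  - by move=> k; have [[cG _ _] _] := GP (p k).1; exact: cG.
  - by move=> k x; have [[_ G0 _] _] := GP (p k).1; exact: G0.
  move=> x [n _ Anx]; have G0 i j : (0 <= (G i j x)%:E)%E.
    by have [[_ G0 _] _] := GP i; rewrite lee_fin.
  rewrite (nneseries_nat_pair (a := fun i j => (G i j x)%:E) pb) //.
  have [[_ _ AG] _] := GP n; apply: le_trans (AG x Anx) _.
  rewrite [leRHS](@nneseriesD1 _ _ n) // ?leeDl //.
    by apply: nneseries_ge0 => i _ _; apply: nneseries_ge0.
  by move=> i _; apply: nneseries_ge0.
rewrite (nneseries_nat_pair (a := fun i j => (Lam (G i j))%:E) pb) //.
apply: lee_nneseries => i _; first by move=> _; apply: nneseries_ge0.
by have [] := GP i.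
Qed.

(* With cutoffs phi_k increasing to 1_U, a family F covering A is split into F (phi_(k+1) - phi_k),
   covering A inside U, and F (1 - phi_n), covering A outside U. *)
Lemma open_upper_caratheodory U : open U ->
  forall A, (upper_measure (A `&` U) + upper_measure (A `&` ~` U) <= upper_measure A)%E.
Proof.
move=> oU A; have [phi [cphi phi0 phiS phiU phi1]] := open_cutoffs oU.
have phi_ge0 k x : 0 <= phi k x by have [/andP[]] := phiS k x.
have phi_le1 k x : phi k x <= 1.
  by have [/andP[_ h] h'] := phiS k x; apply: le_trans h h'.
apply: le_ereal_inf_tmp => _ [F [cF F0 AF] <-].
pose h k x := phi k.+1 x - phi k x.
have ch k : continuous (h k) by exact: cont_sub.
have h0 k x : 0 <= h k x by rewrite subr_ge0; have [/andP[]] := phiS k x.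
have hsum n x : \sum_(k < n) h k x = phi n x.
  by rewrite -(big_mkord xpredT (fun k => h k x)) telescope_sumr // phi0 subr0.
pose a k i := Lam (fun x => F i x * h k x).
have cFh k i : continuous (fun x => F i x * h k x) by exact: cont_mul.
have a0 k i : (0 <= (a k i)%:E)%E.
  by rewrite lee_fin; apply: Lam_ge0 => // x; rewrite mulr_ge0.
have sa0 k : (0 <= \sum_(i <oo) (a k i)%:E)%E by apply: nneseries_ge0.
have AU : (upper_measure (A `&` U) <= \sum_(k <oo) \sum_(i <oo) (a k i)%:E)%E.
  have [p pb] := exists_nat_pair.
  rewrite -(nneseries_nat_pair (a := fun k i => (a k i)%:E) pb) //.
  apply: (@upper_measure_le _ (fun j x => F (p j).2 x * h (p j).1 x)); split => //.
    by move=> j x; rewrite mulr_ge0.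
  move=> x [Ax Ux].
  rewrite (nneseries_nat_pair (a := fun k i => (F i x * h k x)%:E) pb); last first.
    by move=> i j; rewrite lee_fin mulr_ge0.
  have [N phiN] := phi1 x Ux.
  apply: (@le_trans _ _ (\sum_(k <oo) (h k x)%:E)%E).
    apply: le_trans (nneseries_lim_ge N _); last by move=> k _ _; rewrite lee_fin.
    by rewrite sumEFin big_mkord hsum phiN.
  apply: lee_nneseries => k _; first by rewrite lee_fin.
  under eq_eseriesr do rewrite mulrC EFinM.
  rewrite nneseriesZl; last by move=> i _; rewrite lee_fin.
  by rewrite -[leLHS]mule1 lee_wpmul2l ?lee_fin // AF.
have AC n : (upper_measure (A `&` ~` U) + \sum_(k < n) \sum_(i <oo) (a k i)%:E <=
    \sum_(i <oo) (Lam (F i))%:E)%E.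
  pose b i := Lam (fun x => F i x * (1 - phi n x)).
  have cFp i : continuous (fun x => F i x * (1 - phi n x)).
    by apply: cont_mul => //; apply: cont_sub => //; exact: cont_cst.
  have Fp0 i x : 0 <= F i x * (1 - phi n x) by rewrite mulr_ge0 // subr_ge0.
  have b0 i : (0 <= (b i)%:E)%E by rewrite lee_fin; apply: Lam_ge0.
  apply: (@le_trans _ _ (\sum_(i <oo) (b i)%:E + \sum_(k < n) \sum_(i <oo) (a k i)%:E)%E).
    apply: leeD2r; apply: upper_measure_le; split => // x [Ax nUx].
    under eq_eseriesr do rewrite phiU // subr0 mulr1.
    exact: AF.
  rewrite -nneseries_sum // -nneseriesD //; last by move=> i _ _; apply: sume_ge0.
  apply: lee_nneseries => i _; first by rewrite adde_ge0 // sume_ge0.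
  rewrite sumEFin -EFinD lee_fin /a /b.
  rewrite -(Lam_sum n (fun k => cFh k i)) -LamD //; last exact: cont_sum.
  apply: Lam_mono => // [|x _]; first by apply: cont_add => //; exact: cont_sum.
  by rewrite -mulr_sumr hsum -mulrDr subrK mulr1.
rewrite addeC; apply: le_trans (leeD2l _ AU) _.
(* The limit n -> oo in [AC] is taken after subtracting the measure of A outside U, so the case
   where it is infinite is settled separately, by the empty sum. *)
have [S|] := eqVneq (upper_measure (A `&` ~` U)) +oo%E.
  have := AC 0%N; rewrite big_ord0 adde0 S leye_eq => /eqP ->; exact: leey.
rewrite -ltey -ge0_fin_numE ?upper_measure_ge0 // => fA.
rewrite addeC -leeBrDr //; apply: lime_le; first exact: is_cvg_nneseries.
by apply: nearW => n; rewrite leeBrDr // addeC big_mkord; exact: AC.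
Qed.

End Riesz.

(** * The Riesz representation theorem on a compact set *)

Lemma measurable_cont {R : realType} {V : normedModType R} (f : V -> R)
  (D : set (g_sigma_algebraType (@open V))) :
  continuous f -> measurable_fun D (f : g_sigma_algebraType (@open V) -> R).
Proof.
move=> /continuousP cf; apply: (measurable_funS measurableT (@subsetT _ _)).
apply: (measurability _ (RGenOpens.measurableE R)).
move=> _ [_ [a [b ->] <-]]; rewrite setTI.
by apply: sub_sigma_algebra; apply: cf; exact: interval_open.
Qed.

Section RieszMeasure.
Context {R : realType} {V : normedModType R}.
Variables (K : set V) (Lam : (V -> R) -> R).
Hypothesis Kc : compact K.
Hypothesis LamD : forall f g : V -> R, continuous f -> continuous g ->
  Lam (fun x => f x + g x) = Lam f + Lam g.
Hypothesis LamZ : forall (t : R) (f : V -> R), continuous f ->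
  Lam (fun x => t * f x) = t * Lam f.
Hypothesis Lam_le : forall (f : V -> R) (c : R), continuous f ->
  (forall x, K x -> f x <= c) -> Lam f <= c.

Let T := g_sigma_algebraType (@open V).
Let nu : set T -> \bar R := upper_measure Lam.

Let nu0 : nu set0 = 0%E.
Proof. exact: upper_measure0 LamZ Lam_le. Qed.

Let nu_ge0 A : (0 <= nu A)%E.
Proof. exact: upper_measure_ge0 LamZ Lam_le _. Qed.

Let outer : {outer_measure set V -> \bar R} := HB.pack (upper_measure Lam)
  (isOuterMeasure.Build R V (upper_measure Lam) nu0 nu_ge0 (@upper_measure_homo _ _ Lam)
    (upper_measure_sigma_subadditive LamZ Lam_le)).

(** Open sets are Caratheodory measurable by [open_upper_caratheodory], hence so is the
    sigma-algebra they generate, on which the outer measure is sigma-additive. *)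
Lemma Riesz_sigma_additive : semi_sigma_additive nu.
Proof.
move=> A mA tA mUA.
have sub (B : set T) : measurable B -> outer.-caratheodory B.
  move=> mB; have : (measurable : set (set (caratheodory_type outer))) B; last by [].
  move: B mB; apply: smallest_sub; first exact: sigma_algebra_measurable.
  move=> U oU; apply: le_caratheodory_measurable.
  exact: open_upper_caratheodory LamD LamZ Lam_le _ oU.
apply: (caratheodory_measure_sigma_additive (mu := outer)) => //.
  by move=> n; apply: sub.
exact: sub.
Qed.

HB.instance Definition _ := isMeasure.Build _ T R nu nu0 nu_ge0 Riesz_sigma_additive.

(** The lower bound is a Dini argument: the partial sums of a covering family are continuous and
    nondecreasing, with limit at least 1, so by compactness one of them is at least 1 - e on all of
    K, and then so is its value under Lam. *)
Lemma Riesz_setT : nu setT = 1%E.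
Proof.
apply/eqP; rewrite eq_le; apply/andP; split.
  rewrite -(Lam_cst LamZ Lam_le 1).
  apply: (upper_measure_le_fun LamZ Lam_le) => //; exact: cont_cst.
apply: le_ereal_inf_tmp => _ [F [cF F0 TF] <-].
have LF i : (0 <= (Lam (F i))%:E)%E by rewrite lee_fin (Lam_ge0 LamZ Lam_le).
apply/lee_addgt0Pr => e e0.
have /compact_near_coveringP/(_ nat \oo (fun N x => 1 - e <= \sum_(i < N) F i x)) := Kc.
case.
  move=> x Kx; have : (((1 - e)%:E : \bar R) < \sum_(i <oo) (F i x)%:E)%E.
    by apply: lt_le_trans (TF x I); rewrite lte_fin ltrBlDr ltrDl.
  move=> xF; have [N xN] : exists N, 1 - e < \sum_(i < N) F i x.
    apply: contrapT => /forallNP h; move: xF; rewrite ltNge => /negP; apply.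
    apply: lime_le; first by apply: is_cvg_nneseries => i _ _; rewrite lee_fin.
    apply: nearW => N; rewrite sumEFin lee_fin big_mkord leNgt; exact/negP/h.
  have cS : continuous (fun x => \sum_(i < N) F i x) by apply: cont_sum.
  exists ([set y | 1 - e < \sum_(i < N) F i y], [set n | (N <= n)%N]) => /=.
    split; last by exists N.
    by apply: (cvgr_gt (\sum_(i < N) F i x)) => //; exact: cS.
  move=> [y n] [/= /ltW yN Nn]; apply: le_trans yN _.
  rewrite -(subnKC Nn) big_split_ord /= lerDl; exact: sumr_ge0.
move=> N _ /(_ N) /= KN.
have {}KN x : K x -> 1 - e <= \sum_(i < N) F i x by apply: KN; rewrite /=.
apply: (@le_trans _ _ ((\sum_(i < N) Lam (F i))%:E + e%:E)%E).
  rewrite -EFinD lee_fin -lerBlDr -(Lam_sum LamD LamZ Lam_le) //.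
  by apply: (Lam_ge LamZ Lam_le) => //; exact: cont_sum.
rewrite leeD2r // -sumEFin -(big_mkord xpredT (fun i => (Lam (F i))%:E)).
exact: nneseries_lim_ge.
Qed.

HB.instance Definition _ := Measure_isProbability.Build _ T R nu Riesz_setT.

Let P : probability T R := nu.

Let K0 : K !=set0.
Proof.
apply/set0P/eqP => KE; have := @Lam_le (fun _ => 0) (-1) (@cont_cst _ _ 0).
by rewrite (Lam_cst LamZ Lam_le) KE => /(_ (fun x => False_ind _)); lra.
Qed.

Let mK : measurable (K : set T).
Proof.
rewrite -[K]setCK; apply: measurableC; apply: sub_sigma_algebra.
by rewrite openC; apply: compact_closed => //; exact: norm_hausdorff.
Qed.

(** The functions i d(x, K) vanish on K, so Lam sends them to 0, yet at each point off K one of them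
    exceeds 1. *)
Let Riesz_setC : nu (~` K) = 0%E.
Proof.
apply/eqP; rewrite eq_le nu_ge0 andbT.
pose F i x := i%:R * set_dist K x.
have cF i : continuous (F i).
  by apply: cont_mul; [exact: cont_cst|exact: continuous_set_dist].
have F0 i x : 0 <= F i x by rewrite mulr_ge0 // set_dist_ge0.
have -> : (0 = \sum_(i <oo) (Lam (F i))%:E)%E.
  rewrite eseries0 // => i _ _; apply/eqP; rewrite eqe eq_le (Lam_ge0 LamZ Lam_le) // andbT.
  by apply: Lam_le => // x Kx; rewrite /F set_dist0 // mulr0.
apply: upper_measure_le; split => // x Kx.
have d0 : 0 < set_dist K x.
  by apply: set_dist_gt0 => //; apply: compact_closed => //; exact: norm_hausdorff.
pose i := Num.bound (set_dist K x)^-1.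
have Fi : 1 <= F i x.
  by rewrite /F -ler_pdivrMr // mul1r ltW // archi_boundP // invr_ge0 ltW.
rewrite (@nneseriesD1 _ _ i) //; last by move=> j _; rewrite lee_fin.
apply: le_trans (leeDl _ _); first by rewrite lee_fin.
by apply: nneseries_ge0 => j _ _; rewrite lee_fin.
Qed.

Let Riesz_K : nu K = 1%E.
Proof.
have := measureU P mK (measurableC mK) (setICr K).
by rewrite setUCr /= Riesz_setT Riesz_setC adde0.
Qed.

(* Layer cake: N f = sum_(j < N) clamp01 (N f - j), where clamp01 (N f - j) is at most the
   indicator of {N f >= j}, which is at most clamp01 (N f - j + 1). *)
Lemma Riesz_integral_le (f : V -> R) : continuous f -> (forall x, K x -> 0 <= f x <= 1) ->
  (\int[P]_(x in K) (f x)%:E <= (Lam f)%:E)%E.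
Proof.
move=> cf f01; apply/lee_addgt0Pr => e e0.
pose M := Num.bound e^-1; pose N := M.+1.
have N0 : 0 < N%:R :> R by [].
have Ne : N%:R^-1 <= e.
  rewrite -[e]invrK lef_pV2 ?posrE ?invr_gt0 // ltW //.
  apply: lt_trans (archi_boundP _) _; first by rewrite invr_ge0 ltW.
  by rewrite ltr_nat.
pose c (j : nat) (y : V) : R := clamp01 (N%:R * f y - j%:R).
have cc j : continuous (c j).
  apply: continuous_clamp01; apply: cont_sub; last exact: cont_cst.
  by apply: cont_mul => //; exact: cont_cst.
have c0 j y : 0 <= c j y by exact: clamp01_ge0.
have csum m y : K y -> \sum_(j < m) c j y = Num.min (N%:R * f y) m%:R.
  by move=> Ky; rewrite sum_clamp01 // mulr_ge0 //; have /andP[] := f01 y Ky.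
have mc j D : measurable_fun D (fun y : T => (N%:R^-1 * c j y)%:E).
  apply/measurable_EFinP; apply: (@measurable_cont _ _ (fun y => N%:R^-1 * c j y)).
  by apply: cont_mul => //; exact: cont_cst.
have -> : (\int[P]_(x in K) (f x)%:E =
    \sum_(j < N) \int[P]_(x in K) (N%:R^-1 * c j x)%:E)%E.
  rewrite -ge0_integral_sum //; last by move=> j y _; rewrite lee_fin mulr_ge0 // invr_ge0.
  apply: eq_integral => y; rewrite inE => Ky; rewrite sumEFin -mulr_sumr csum //.
  rewrite (min_idPl _); first by rewrite mulrA mulVf ?mul1r // gt_eqF.
  by rewrite ger_pMr //; have /andP[] := f01 y Ky.
pose g j y : R := clamp01 (N%:R * f y - j%:R + 1).
have cg j : continuous (g j).
  apply: continuous_clamp01; apply: cont_add; last exact: cont_cst.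
  apply: cont_sub; last exact: cont_cst.
  by apply: cont_mul => //; exact: cont_cst.
have gle j : (\int[P]_(x in K) (N%:R^-1 * c j x)%:E <= (N%:R^-1 * Lam (g j))%:E)%E.
  pose B := [set y : T | j%:R <= N%:R * f y].
  have mB : measurable B.
    have -> : B = [set: T] `&` (fun y => N%:R * f y) @^-1` `[j%:R, +oo[%classic.
      by rewrite setTI; apply/seteqP; split => y /=; rewrite /B /= in_itv /= andbT.
    apply: (@measurable_cont _ _ (fun y => N%:R * f y)) => //.
    by apply: cont_mul => //; exact: cont_cst.
  apply: (@le_trans _ _ (\int[P]_(x in K) ((N%:R^-1)%:E * (\1_B x)%:E))%E).
    apply: ge0_le_integral => //.
    - by move=> y _; rewrite lee_fin mulr_ge0 // invr_ge0.
    - by apply/measurable_EFinP; apply: measurable_funM => //; exact: measurable_indic.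
    move=> y _; rewrite -EFinM lee_fin ler_wpM2l ?invr_ge0 // indicE.
    have [yB|yB] := boolP (y \in B); first exact: clamp01_le1.
    rewrite /c clamp01_le0 //= subr_le0 leNgt; apply/negP => /ltW h.
    by move: yB; rewrite notin_setE; apply.
  rewrite ge0_integralZl_EFin ?invr_ge0 //; last first.
    by apply/measurable_EFinP; exact: measurable_indic.
  rewrite EFinM lee_wpmul2l ?lee_fin ?invr_ge0 // integral_indic //.
  apply: (@le_trans _ _ (P B)); first by apply: le_measure; rewrite ?inE //; exact: measurableI.
  apply: (upper_measure_le_fun LamZ Lam_le) => // [x|x Bx]; first exact: clamp01_ge0.
  by rewrite /g clamp01_ge1 // lerDr subr_ge0.
apply: (@le_trans _ _ (\sum_(j < N) (N%:R^-1 * Lam (g j))%:E)%E).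
  by apply: lee_sum => j _; exact: gle.
(* The layer j = 0 costs at most 1/N <= e; each remaining [g (j+1)] is [c j], and these sum to at
   most N f on K. *)
rewrite sumEFin -EFinD lee_fin -mulr_sumr big_ord_recl.
have g0 : Lam (g 0%N) <= 1.
  by apply: Lam_le => // x _; exact: clamp01_le1.
have gS : \sum_(i < M) Lam (g (lift ord0 i)) <= N%:R * Lam f.
  rewrite -LamZ //.
  rewrite (eq_bigr (fun i : 'I_M => Lam (c i))); last first.
    move=> i _; congr Lam; apply/funext => y; rewrite /g /c lift0 -natr1.
    by congr clamp01; lra.
  rewrite -(Lam_sum LamD LamZ Lam_le) //; apply: (Lam_mono LamD LamZ Lam_le).
  - exact: cont_sum.
  - by apply: cont_mul => //; exact: cont_cst.
  by move=> x Kx; rewrite csum // ge_min lexx.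
rewrite ler_pdivrMl //; have : N%:R * N%:R^-1 <= N%:R * e by rewrite ler_pM2l.
by rewrite mulfV ?gt_eqF // mulrDr; lra.
Qed.

(** The reverse inequality is [Riesz_integral_le] for 1 - f, since both the integrals over K and the
    values of Lam add up to 1. *)
Lemma Riesz_integral01 (f : V -> R) : continuous f -> (forall x, K x -> 0 <= f x <= 1) ->
  (\int[P]_(x in K) (f x)%:E = (Lam f)%:E)%E.
Proof.
move=> cf f01; have le1 := Riesz_integral_le cf f01.
have cf' : continuous (fun x => 1 - f x) by apply: cont_sub => //; exact: cont_cst.
have f01' x : K x -> 0 <= 1 - f x <= 1.
  by move=> Kx; have /andP[? ?] := f01 x Kx; rewrite subr_ge0 gerBl; apply/andP.
have le2 := Riesz_integral_le cf' f01'.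
have Lf' : Lam (fun x => 1 - f x) = 1 - Lam f.
  have := LamD cf cf'; under eq_fun do rewrite addrC subrK.
  by rewrite (Lam_cst LamZ Lam_le); lra.
have sum1 : (\int[P]_(x in K) (f x)%:E + \int[P]_(x in K) (1 - f x)%:E = 1)%E.
  rewrite -ge0_integralD //.
  - under eq_integral do rewrite -EFinD addrC subrK.
    by rewrite integral_cst //= Riesz_K mule1.
  - by move=> x Kx; rewrite lee_fin; have /andP[] := f01 x Kx.
  - by apply/measurable_EFinP; exact: measurable_cont.
  - by move=> x Kx; rewrite lee_fin; have /andP[] := f01' x Kx.
  - by apply/measurable_EFinP; exact: measurable_cont.
rewrite Lf' in le2; move: le1 le2 sum1.
move: (\int[P]_(x in K) (f x)%:E)%E (\int[P]_(x in K) (1 - f x)%:E)%E => [a| |] [b| |] //.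
by rewrite -EFinD !lee_fin => h1 h2 [h3]; congr EFin; lra.
Qed.

Theorem riesz_representation : exists Q : probability T R, forall f : V -> R, continuous f ->
  Q.-integrable setT (EFin \o f) /\ (\int[Q]_x (f x)%:E = (Lam f)%:E)%E.
Proof.
exists P => f cf.
have mf D : measurable_fun D (EFin \o (f : T -> R)).
  by apply/measurable_EFinP; exact: measurable_cont.
have [C0 [_ fC0]] : bounded_set (f @` K).
  by apply: compact_bounded; apply: continuous_compact => //; exact: continuous_subspaceT.
pose C : R := `|C0| + 1; have C_gt0 : 0 < C by rewrite ltr_wpDl.
have fC x : K x -> `|f x| <= C.
  move=> Kx; apply: (fC0 C); last by exists x.
  by rewrite /C (le_lt_trans (ler_norm C0)) // ltrDl.
have iK (h : V -> R) : continuous h -> P.-integrable K (EFin \o h).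
  move=> ch; apply: measurable_bounded_integrable => //.
  - by rewrite /= Riesz_K ltry.
  - exact: measurable_cont.
  have : bounded_set (h @` K).
    by apply: compact_bounded; apply: continuous_compact => //; exact: continuous_subspaceT.
  by move=> [B [Br hB]]; exists B; split => // b Bb x Kx; apply: hB => //; exists x.
have KE : [set: T] `\` ~` K = K by rewrite setTD setCK.
have iT : P.-integrable setT (EFin \o f).
  apply/(negligible_integrable (measurableC mK)) => //; rewrite KE; exact: iK.
split => //.
(* With C a positive bound for |f| on K, the affine rescaling (f + C) / (2 C) takes values in [0,1]
   on K. *)
rewrite (negligible_integral (measurableC mK)) // KE.
pose g x : R := (2 * C)^-1 * (f x + C).
have cg : continuous g by apply: cont_mul; [exact: cont_cst|apply: cont_add => //; exact: cont_cst].
have g01 x : K x -> 0 <= g x <= 1.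
  move=> Kx; have := fC x Kx; rewrite ler_norml => /andP[h1 h2].
  rewrite /g mulr_ge0 ?invr_ge0 ?mulr_ge0 ?(ltW C_gt0) //=; last by lra.
  by rewrite ler_pdivrMl ?mulr_gt0 //; lra.
have fg : f = (fun x => 2 * C * g x + - C).
  by apply/funext => x; rewrite /g mulrA mulfV ?mul1r ?addrK // gt_eqF // mulr_gt0.
have -> : Lam f = 2 * C * Lam g - C.
  rewrite fg (@LamD (fun x => 2 * C * g x) (fun _ => - C)).
  - by rewrite LamZ // (Lam_cst LamZ Lam_le).
  - by move=> x; apply: (@cont_mul _ _ (fun _ => 2 * C) g) => //; exact: cont_cst.
  - exact: cont_cst.
rewrite (eq_integral (fun x : T => ((2 * C)%:E * (g x)%:E + (- C)%:E)%E)); last first.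
  by move=> x _; rewrite {1}fg.
rewrite integralD //=; last 2 first.
- by apply: integrableZl => //; exact: iK.
- by apply: (iK (fun _ => - C)); exact: cont_cst.
rewrite integralZl //; last exact: iK.
by rewrite Riesz_integral01 // integral_cst // /= Riesz_K mule1.
Qed.

End RieszMeasure.

(** * Strict directional derivatives of C^1 functions *)

Section DirectionalDerivatives.
Context {R : realType} {V : normedModType R}.
Implicit Types (f : V -> R) (x y u v w : V).

Lemma cvg_derive_quotient f x v a :
  (forall e, 0 < e -> exists2 d, 0 < d & forall t, t != 0 -> `|t| < d ->
     `|f (x + t *: v) - f x - t * a| <= e * `|t|) ->
  (fun h => h^-1 *: ((f \o shift x) (h *: v) - f x)) @ 0^' --> (a : R).
Proof.
move=> H; apply/cvgrPdist_le => e e0; have [d d0 Hd] := H e e0.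
near=> t.
have t0 : t != 0 by near: t; exact: nbhs_dnbhs_neq.
have td : `|t| < d.
  near: t; apply: dnbhs0_lt; exact: d0.
have tp : 0 < `|t| by rewrite normr_gt0.
rewrite distrC -(ler_pM2r tp) -normrM mulrBl /=.
have := Hd t t0 td; rewrite (addrC x) /GRing.scale /= mulrAC mulVf // mul1r (mulrC t a); exact.
Unshelve. all: by end_near. Qed.

Lemma is_derive_line f x v s : derivable f (x + s *: v) v ->
  is_derive s 1 (fun t : R => f (x + t *: v)) ('D_v f (x + s *: v)).
Proof.
move=> df; have cv : (fun h => h^-1 *: (((fun t : R => f (x + t *: v)) \o shift s) (h *: 1) -
    f (x + s *: v))) @ 0^' --> 'D_v f (x + s *: v).
  rewrite (_ : (fun _ => _) =
    (fun h => h^-1 *: ((f \o shift (x + s *: v)) (h *: v) - f (x + s *: v)))) //.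
  apply/funext => h /=; rewrite [h *: 1]mulr1; congr (_ *: (f _ - _)).
  by rewrite scalerDl addrCA.
by split; [exact: cvgP cv|apply: cvg_lim => //; exact: Rhausdorff].
Qed.

Lemma isC1_mvt f x v t : isC1 f -> 0 <= t ->
  exists2 s, 0 <= s <= t & f (x + t *: v) - f x = t * 'D_v f (x + s *: v).
Proof.
move=> [cf df] t0.
have cl : {within `[0, t], continuous (fun s : R => f (x + s *: v))}.
  apply: continuous_subspaceT => s.
  apply: (@continuous_comp _ _ _ (fun s : R => x + s *: v) f); last exact: cf.
  apply: (@continuousD _ _ _ (fun=> x) (fun s : R => s *: v)); first exact: cst_continuous.
  exact: scalel_continuous.
have [s st H] := MVT_segment t0 (fun s _ => is_derive_line ((df v).1 _)) cl.
exists s; first by move: st; rewrite in_itv.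
by move: H; rewrite scale0r addr0 subr0 mulrC.
Qed.

(** A one-sided strict derivative: the base point y also varies near x. This is what allows
    directions to be added, the second increment starting at y + t u, and reversed, by starting at y
    - t u. *)
Definition strict_dir f x u (a : R) := forall e, 0 < e -> exists2 d, 0 < d &
  forall y t, `|y - x| < d -> 0 < t < d -> `|f (y + t *: u) - f y - t * a| <= e * t.

Lemma isC1_strict_dir f x u : isC1 f -> strict_dir f x u ('D_u f x).
Proof.
move=> fC e e0; have [cf df] := fC.
have /cvgrPdist_le/(_ e e0)/nbhs_ballP[d /= d0 H] := (df u).2 x.
have u0 : 0 < 1 + `|u| by rewrite ltr_pwDl.
exists (d / 2 / (1 + `|u|)); first by rewrite !divr_gt0.
move=> y t yd /andP[t0 td].
have [s /andP[s0 st] ->] := isC1_mvt y u fC (ltW t0).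
rewrite -mulrBr normrM (gtr0_norm t0) mulrC ler_pM2r // distrC; apply: H.
rewrite -ball_normE /= opprD addrA; apply: le_lt_trans (ler_normB _ _) _.
rewrite normrZ (ger0_norm s0) [ltRHS](splitr d) ltrD //.
  rewrite distrC; apply: lt_le_trans yd _; rewrite ler_pdivrMr // ler_peMr ?lerDl //.
  by rewrite divr_ge0 // ltW.
apply: (@le_lt_trans _ _ (t * (1 + `|u|))); last by rewrite -ltr_pdivlMr.
by rewrite ler_pM // lerDr.
Qed.

Lemma strict_dir_unique f x u a b : strict_dir f x u a -> strict_dir f x u b -> a = b.
Proof.
move=> Ha Hb; apply/eqP; rewrite -subr_eq0 -normr_le0; apply/ler_addgt0Pr => e e0.
rewrite add0r; have e2 : 0 < e / 2 by rewrite divr_gt0.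
have [d d0 {}Ha] := Ha _ e2; have [d' d'0 {}Hb] := Hb _ e2.
pose t := Num.min d d' / 2.
have m0 : 0 < Num.min d d' by rewrite lt_min d0.
have t0 : 0 < t by rewrite divr_gt0.
have tm : t < Num.min d d' by rewrite ltr_pdivrMr // ltr_pMr // ltr1n.
have /andP[td td'] : (t < d) && (t < d') by rewrite -lt_min.
have := Ha x t; have := Hb x t; rewrite subrr normr0 d0 d'0 t0 td td' => /(_ isT isT) h1 /(_ isT isT) h2.
rewrite -(ler_pM2l t0) -[t in leLHS](gtr0_norm t0) -normrM.
have -> : t * (a - b) = (f (x + t *: u) - f x - t * b) - (f (x + t *: u) - f x - t * a) by ring.
by apply: le_trans (ler_normB _ _) _; move: h1 h2; lra.
Qed.

Lemma strict_dirD f x u w a b : strict_dir f x u a -> strict_dir f x w b ->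
  strict_dir f x (u + w) (a + b).
Proof.
move=> Ha Hb e e0; have e2 : 0 < e / 2 by rewrite divr_gt0.
have [d d0 {}Ha] := Ha _ e2; have [d' d'0 {}Hb] := Hb _ e2.
have u0 : 0 < 1 + `|u| by rewrite ltr_pwDl.
exists (Num.min d (d' / 2 / (1 + `|u|))); first by rewrite lt_min d0 !divr_gt0.
move=> y t; rewrite !lt_min => /andP[yd yd'] /and3P[t0 td td'].
have h1 := Ha y t yd; rewrite t0 td in h1; have {}h1 := h1 isT.
have le1 : d' / 2 / (1 + `|u|) <= d' / 2.
  by rewrite ler_pdivrMr // ler_peMr ?lerDl // divr_ge0 // ltW.
have h2 := Hb (y + t *: u) t; rewrite t0 in h2.
have : `|f (y + t *: u + t *: w) - f (y + t *: u) - t * b| <= e / 2 * t.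
  apply: h2; last by rewrite /= (lt_le_trans td') // (le_trans le1) // ler_pdivrMr // ler_pMr // ler1n.
  rewrite addrAC; apply: le_lt_trans (ler_normD _ _) _.
  rewrite normrZ (gtr0_norm t0) [ltRHS](splitr d') ltr_leD //; first exact: lt_le_trans yd' le1.
  apply: (@le_trans _ _ (t * (1 + `|u|))); first by rewrite ler_pM2l // lerDr.
  by rewrite -ler_pdivlMr // ltW.
rewrite scalerDr addrA => h3.
have -> : f (y + t *: u + t *: w) - f y - t * (a + b) =
  (f (y + t *: u) - f y - t * a) + (f (y + t *: u + t *: w) - f (y + t *: u) - t * b) by ring.
by apply: le_trans (ler_normD _ _) _; move: h1 h3; lra.
Qed.

Lemma strict_dirZ_gt0 f x u a c : 0 < c -> strict_dir f x u a ->
  strict_dir f x (c *: u) (c * a).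
Proof.
move=> c0 Ha e e0; have ec : 0 < e / c by rewrite divr_gt0.
have [d d0 {}Ha] := Ha _ ec.
exists (Num.min d (d / c)); first by rewrite lt_min d0 divr_gt0.
move=> y t; rewrite !lt_min => /andP[yd _] /and3P[t0 _ td].
have := Ha y (t * c) yd; rewrite mulr_gt0 //= -ltr_pdivlMr // td => /(_ isT).
by rewrite scalerA -mulrA (mulrC t c) [e / c * _]mulrA divfK // gt_eqF.
Qed.

Lemma strict_dirN f x u a : strict_dir f x u a -> strict_dir f x (- u) (- a).
Proof.
move=> Ha e e0; have [d d0 {}Ha] := Ha _ e0.
have u0 : 0 < 1 + `|u| by rewrite ltr_pwDl.
exists (d / 2 / (1 + `|u|)); first by rewrite !divr_gt0.
move=> y t yd /andP[t0 td].
have le1 : d / 2 / (1 + `|u|) <= d / 2.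
  by rewrite ler_pdivrMr // ler_peMr ?lerDl // divr_ge0 // ltW.
have := Ha (y + t *: - u) t; rewrite t0.
rewrite scalerN subrK.
have -> : f y - f (y - t *: u) - t * a = - (f (y - t *: u) - f y - t * - a) by ring.
rewrite normrN; apply; last first.
  by rewrite /= (lt_le_trans td) // (le_trans le1) // ler_pdivrMr // ler_pMr // ler1n.
rewrite addrAC; apply: le_lt_trans (ler_normB _ _) _.
rewrite normrZ (gtr0_norm t0) [ltRHS](splitr d) ltr_leD //; first exact: lt_le_trans yd le1.
apply: (@le_trans _ _ (t * (1 + `|u|))); first by rewrite ler_pM2l // lerDr.
by rewrite -ler_pdivlMr // ltW.
Qed.

Lemma strict_dir0 f x : strict_dir f x 0 0.
Proof.
move=> e e0; exists 1 => // y t _ /andP[t0 _].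
by rewrite scaler0 addr0 mulr0 !subrr normr0 mulr_ge0 // ltW.
Qed.

Lemma strict_dirZ f x u a c : strict_dir f x u a -> strict_dir f x (c *: u) (c * a).
Proof.
move=> Ha; have [c0|c0|->] := ltgtP c 0; last by rewrite scale0r mul0r; exact: strict_dir0.
  rewrite -[c]opprK scaleNr mulNr; apply: strict_dirN; apply: strict_dirZ_gt0 => //.
  by rewrite oppr_gt0.
exact: strict_dirZ_gt0.
Qed.

(** [isC1] provides derivatives one direction at a time; linearity in the direction comes from
    additivity and uniqueness of strict derivatives. *)
Lemma isC1_derive_sum f x (I : Type) (s : seq I) (c : I -> R) (e : I -> V) : isC1 f ->
  'D_(\sum_(i <- s) c i *: e i) f x = \sum_(i <- s) c i * 'D_(e i) f x.
Proof.
move=> fC; apply: (strict_dir_unique (isC1_strict_dir _ _ fC)).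
elim: s => [|i s IH]; first by rewrite !big_nil; exact: strict_dir0.
rewrite !big_cons; apply: strict_dirD IH; apply: strict_dirZ; exact: isC1_strict_dir.
Qed.

(** A remainder of order t^2 is what both quadratic functions and averages of Lipschitz functions
    provide. *)
Lemma isC1_of_incr f (g : V -> V -> R) : continuous f -> (forall v, continuous (g v)) ->
  (forall x v, exists C d, 0 < d /\ forall t, `|t| <= d ->
    `|f (x + t *: v) - f x - t * g v x| <= C * t ^+ 2) ->
  isC1 f /\ forall v x, 'D_v f x = g v x.
Proof.
move=> cf cg H.
have cv x v : (fun h => h^-1 *: ((f \o shift x) (h *: v) - f x)) @ 0^' --> g v x.
  apply: cvg_derive_quotient => e e0; have [C [d [d0 HC]]] := H x v.
  have C0 : 0 < `|C| + 1 by rewrite ltr_wpDl.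
  exists (Num.min d (e / (`|C| + 1))); first by rewrite lt_min d0 divr_gt0.
  move=> t t0; rewrite lt_min => /andP[/ltW t1 te]; apply: le_trans (HC t t1) _.
  rewrite -(real_normK (num_real t)) expr2 mulrA ler_wpM2r //.
  rewrite ltr_pdivlMr // in te; apply: le_trans (ltW te).
  rewrite mulrC ler_wpM2l //; apply: le_trans (ler_norm C) _; by rewrite lerDl.
have D v x : 'D_v f x = g v x by apply: cvg_lim => //; exact: Rhausdorff.
split => //; split => // v; split; first by move=> x; exact: cvgP (cv x v).
by rewrite (_ : 'D_v f = g v) //; apply/funext => x.
Qed.

End DirectionalDerivatives.

(** * Row vectors, periodicity and quadratic test functions *)

Section RowVectors.
Context {R : realType} {n : nat}.
Local Notation X := 'rV[R]_n.
Implicit Types x y v : X.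

Lemma rv_coord_le x i : `|x 0 i| <= `|x|.
Proof.
rewrite [leRHS]mx_normrE.
exact: (@le_bigmax _ _ _ 0 (fun ij : 'I_1 * 'I_n => `|x ij.1 ij.2|) (0, i)).
Qed.

Lemma rv_norm_le x r : 0 <= r -> (forall i, `|x 0 i| <= r) -> `|x| <= r.
Proof.
move=> r0 H; rewrite [leLHS]mx_normrE; apply: bigmax_le => // -[i j] _ /=.
by rewrite ord1.
Qed.

(** The norm on row vectors is the maximum norm, whence the factor n. *)
Lemma dotv_norm_le x y : `|dotv x y| <= n%:R * (`|x| * `|y|).
Proof.
apply: le_trans (ler_norm_sum _ _ _) _.
apply: (@le_trans _ _ (\sum_(i < n) `|x| * `|y|)).
  by apply: ler_sum => i _; rewrite normrM ler_pM // rv_coord_le.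
by rewrite sumr_const card_ord mulr_natl.
Qed.

Lemma dotvDl x y v : dotv (x + y) v = dotv x v + dotv y v.
Proof. by rewrite /dotv -big_split /=; apply: eq_bigr => i _; rewrite mxE mulrDl. Qed.

Lemma dotvDr x y v : dotv v (x + y) = dotv v x + dotv v y.
Proof. by rewrite /dotv -big_split /=; apply: eq_bigr => i _; rewrite mxE mulrDr. Qed.

Lemma dotvZl t x v : dotv (t *: x) v = t * dotv x v.
Proof. by rewrite /dotv mulr_sumr; apply: eq_bigr => i _; rewrite mxE mulrA. Qed.

Lemma dotvZr t x v : dotv v (t *: x) = t * dotv v x.
Proof. by rewrite /dotv mulr_sumr; apply: eq_bigr => i _; rewrite mxE mulrCA. Qed.

Lemma dotvC x y : dotv x y = dotv y x.
Proof. by apply: eq_bigr => i _; rewrite mulrC. Qed.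

Lemma dotv_unitv x i : dotv x (unitv R i) = x 0 i.
Proof.
rewrite /dotv (bigD1 i) //= /unitv mxE !eqxx mulr1 big1 ?addr0 // => j ji.
by rewrite mxE (negPf ji) andbF mulr0.
Qed.

Lemma dotv_sq_ge0 x : 0 <= dotv x x.
Proof. by apply: sumr_ge0 => i _; rewrite -expr2 sqr_ge0. Qed.

Lemma sqr_norm_le_dotv x : `|x| ^+ 2 <= dotv x x.
Proof.
suff : `|x| <= Num.sqrt (dotv x x).
  by move=> h; rewrite -[leRHS]sqr_sqrtr ?dotv_sq_ge0 // ler_sqr ?nnegrE ?sqrtr_ge0.
apply: rv_norm_le => [|i]; first exact: sqrtr_ge0.
rewrite -sqrtr_sqr ler_sqrt ?dotv_sq_ge0 // /dotv (bigD1 i) //= expr2 lerDl.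
by apply: sumr_ge0 => j _; rewrite -expr2 sqr_ge0.
Qed.

Lemma cont_coord (T : topologicalType) (f : T -> X) i : continuous f ->
  continuous (fun t => f t 0 i).
Proof.
move=> cf; apply: (@cont_comp _ _ _ f (fun M : X => M 0 i) cf).
exact: coord_continuous.
Qed.

Lemma cont_row (T : topologicalType) (f : 'I_n -> T -> R) : (forall i, continuous (f i)) ->
  continuous (fun t => \row_i f i t : X).
Proof.
move=> cf t; apply/cvgrPdist_le => e e0.
have : \forall s \near t, forall i : 'I_n, `|f i t - f i s| <= e.
  by apply: filter_forall => i; have /cvgrPdist_le/(_ e e0) := cf i t.
apply: filterS => s H; apply: rv_norm_le; first exact: ltW.
by move=> i; rewrite !mxE; exact: H.
Qed.

Lemma cont_dotv (T : topologicalType) (f g : T -> X) : continuous f -> continuous g ->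
  continuous (fun t => dotv (f t) (g t)).
Proof.
by move=> cf cg; apply: cont_sum => i; apply: cont_mul; apply: cont_coord.
Qed.

Lemma periodicZ (T : Type) (f : X -> T) : periodic f ->
  forall x i (k : int), f (x + k%:~R *: unitv R i) = f x.
Proof.
move=> pf x i.
have P m : forall y, f (y + m%:R *: unitv R i) = f y.
  elim: m => [|m IH] y; first by rewrite scale0r addr0.
  by rewrite -natr1 scalerDl scale1r addrA pf IH.
case=> m; first exact: P.
by rewrite NegzE mulrNz scaleNr -[in RHS](subrK (m.+1%:R *: unitv R i) x) P.
Qed.

Definition floorv x : X := \row_i (Num.floor (x 0 i))%:~R.
Definition fracv x : X := x - floorv x.

Lemma periodic_shift (T : Type) (f : X -> T) (k : 'I_n -> int) : periodic f ->
  forall x, f (x + \row_i (k i)%:~R) = f x.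
Proof.
move=> pf x; rewrite [\row__ _]row_sum_delta.
under eq_bigr do rewrite mxE.
elim: (index_enum _) => [|i s IH]; first by rewrite big_nil addr0.
by rewrite big_cons addrCA addrC -[RHS]IH -(periodicZ pf (x + _) i (k i)).
Qed.

Lemma periodic_fracv (T : Type) (f : X -> T) : periodic f -> forall x, f (fracv x) = f x.
Proof.
by move=> pf x; rewrite -[in RHS](subrK (floorv x) x) periodic_shift.
Qed.

Lemma fracv_itv x i : 0 <= fracv x 0 i < 1.
Proof.
rewrite !mxE subr_ge0 ltrBlDr addrC.
by rewrite floor_le //= -intrD1 floorD1_gt.
Qed.

Definition cube : set X := [set x | forall i, 0 <= x 0 i <= 1].

Lemma fracv_cube x : cube (fracv x).
Proof. by move=> i; have /andP[-> /ltW ->] := fracv_itv x i. Qed.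

Lemma compact_closed_norm_ball r : compact [set x : X | `|x| <= r].
Proof.
apply: bounded_closed_compact; first by exists r; split; [exact: num_real|
  move=> s rs x /= xr; exact: le_trans xr (ltW rs)].
have -> : [set x : X | `|x| <= r] = (fun x : X => `|x|) @^-1` [set y : R | y <= r] by [].
by apply: closed_comp => [x _|]; [exact: norm_continuous|exact: closed_le].
Qed.

Lemma compact_cube : compact cube.
Proof.
apply: (@subclosed_compact _ _ [set x : X | `|x| <= 1]).
- have -> : cube = \bigcap_(i in [set: 'I_n]) (fun x : X => x 0 i) @^-1` `[0, 1]%classic.
    apply/seteqP; split => x H i.
      by move=> _ /=; rewrite in_itv; exact: H.
    by have := H i I; rewrite /= in_itv.
  apply: closed_bigI => i _; apply: closed_comp => [x _|]; last exact: interval_closed.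
  exact: coord_continuous.
- exact: compact_closed_norm_ball.
move=> x cx /=; apply: rv_norm_le => // i; have /andP[x0 x1] := cx i.
by rewrite ger0_norm.
Qed.

Lemma cube0 : cube !=set0.
Proof. by exists 0 => i; rewrite mxE lexx ler01. Qed.

Lemma periodic_max (f : X -> R) : continuous f -> periodic f ->
  exists2 x, cube x & forall y, f y <= f x.
Proof.
move=> cf pf; have [x xc H] := compact_EVT_max cube0 compact_cube (continuous_subspaceT cf).
exists x; first by rewrite inE in xc.
move=> y; rewrite -(periodic_fracv pf); apply: H; rewrite inE; exact: fracv_cube.
Qed.

Lemma periodic_bounded (f : X -> R) : continuous f -> periodic f ->
  exists2 B, 0 <= B & forall y, `|f y| <= B.
Proof.
move=> cf pf; have [x _ H] := periodic_max (cont_abs cf) (fun x i => congr1 Num.norm (pf x i)).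
by exists `|f x|.
Qed.

Lemma isC1_quadratic (K : R) (c : X) : let q := fun y => K * dotv (y - c) (y - c) in
  isC1 q /\ forall y, grad q y = (2 * K) *: (y - c).
Proof.
move=> q; pose g v y := 2 * K * dotv (y - c) v.
have cb : continuous (fun y : X => y - c).
  by move=> y; apply: continuousB; [exact: cvg_id|exact: cst_continuous].
have [|||qC Dq] := @isC1_of_incr _ _ q g.
- by apply: cont_mul; [exact: cont_cst|exact: cont_dotv].
- move=> v; apply: cont_mul; first exact: cont_cst.
  by apply: cont_dotv => //; exact: cst_continuous.
- move=> x v; exists `|K * dotv v v|, 1; split => // t _.
  rewrite /q /g (_ : x + t *: v - c = x - c + t *: v); last by rewrite addrAC.
  move: (x - c) => z.
  rewrite !dotvDl !dotvDr !dotvZl !dotvZr (dotvC v z).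
  rewrite [X in `|X| <= _](_ : _ = K * dotv v v * t ^+ 2); last by ring.
  by rewrite normrM (ger0_norm (sqr_ge0 t)).
split => // y; apply/rowP => i; rewrite mxE Dq /g dotv_unitv.
by rewrite [RHS]mxE.
Qed.

End RowVectors.

(** * Increments and Lipschitz bounds for viscosity subsolutions *)

Section ViscosityIncrements.
Context {R : realType} {n : nat}.
Local Notation X := 'rV[R]_n.
Implicit Types (x y v : X) (w : X -> R) (H : X -> X -> R).

(* A one-sided bound on q.v over all quadratic test gradients q integrates along the segment:
   otherwise maximize w(x + tau v + z) - s' tau - K|z|^2 with s' > s and K large.  At the maximum
   q = 2 K z is a test gradient, and trading tau against z along v gives q.v >= s'. *)
Lemma segment_increment w x v (T s r B : R) : continuous w -> (forall y, `|w y| <= B) ->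
  0 <= T -> 0 < r ->
  (forall y K c, (exists2 tau, 0 <= tau <= T & `|y - (x + tau *: v)| <= r) ->
     (\forall z \near y, w z - K * dotv (z - c) (z - c) <= w y - K * dotv (y - c) (y - c)) ->
     dotv ((2 * K) *: (y - c)) v <= s) ->
  w (x + T *: v) - w x <= s * T.
Proof.
move=> cw wB T0 r0 H; apply/ler_addgt0Pr => e e0; rewrite leNgt; apply/negP => Hlt.
have Tp : 0 < T.
  rewrite lt_neqAle T0 andbT; apply/eqP => TE; move: Hlt.
  by rewrite -TE scale0r addr0 subrr mulr0 add0r ltNge (ltW e0).
pose eta := e / T; have eta0 : 0 < eta by rewrite divr_gt0.
pose s' := s + eta.
have s'T : s' * T = s * T + e by rewrite mulrDl divfK // gt_eqF.
pose d := w (x + T *: v) - s' * T - w x.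
have d0 : 0 < d by rewrite /d s'T; lra.
have [r1 r10 wr1] : exists2 r1, 0 < r1 & forall z, `|z| <= r1 -> w (x + z) < w x + d.
  have : \forall y \near x, w y < w x + d.
    by apply: (@cvgr_lt _ _ (nbhs x) _ w (w x) (cw x)); rewrite ltrDl.
  move=> /nbhs_ballP[r1 /= r10 Hr]; exists (r1 / 2); first by rewrite divr_gt0.
  move=> z zr; apply: Hr; rewrite -ball_normE /= opprD addrA subrr sub0r normrN.
  by apply: le_lt_trans zr _; rewrite ltr_pdivrMr // ltr_pMr // ltr1n.
pose r' := Num.min r r1; have r'0 : 0 < r' by rewrite lt_min r0.
(* On |z| = r' the penalty exceeds the oscillation of w plus the slope term, so the maximum has |z|
   < r'; the radius r1 excludes tau = 0. *)
pose K := (2 * B + `|s'| * T + 1) / r' ^+ 2.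
have B0 : 0 <= B by apply: le_trans (wB x).
have K0 : 0 < K by rewrite divr_gt0 ?exprn_gt0 // ltr_wpDl // addr_ge0 // mulr_ge0.
pose Phi (p : R * X) := w (x + p.1 *: v + p.2) - s' * p.1 - K * dotv p.2 p.2.
have cfst : continuous (fun p : R * X => p.1) by move=> p; exact: cvg_fst.
have csnd : continuous (fun p : R * X => p.2) by move=> p; exact: cvg_snd.
have cPhi : continuous Phi.
  apply: cont_sub; last by apply: cont_mul; [exact: cont_cst|exact: cont_dotv].
  apply: cont_sub; last by apply: cont_mul; [exact: cont_cst|].
  apply: (@cont_comp _ _ _ (fun p : R * X => x + p.1 *: v + p.2) w) cw => p.
  apply: (@continuousD _ _ _ (fun p : R * X => x + p.1 *: v) snd); last exact: csnd.
  apply: (@continuousD _ _ _ (fun=> x) (fun p : R * X => p.1 *: v)); first exact: cst_continuous.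
  by apply: (@continuous_comp _ _ _ fst (fun t : R => t *: v)); [exact: cfst|exact: scalel_continuous].
have [[tau z] pin Pmax] : exists2 p, p \in `[0, T]%classic `*` [set z : X | `|z| <= r'] &
    forall q, q \in `[0, T]%classic `*` [set z : X | `|z| <= r'] -> Phi q <= Phi p.
  apply: compact_EVT_max.
  - by exists (0, 0); split => /=; rewrite ?in_itv /= ?lexx ?T0 // normr0 ltW.
  - exact: (compact_setX (@segment_compact _ 0 T) (@compact_closed_norm_ball _ _ r')).
  - exact: continuous_subspaceT.
have {}Pmax t u : 0 <= t <= T -> `|u| <= r' -> Phi (t, u) <= Phi (tau, z).
  by move=> tT ur; apply: Pmax; rewrite inE; split => //=; rewrite in_itv.
move: pin; rewrite inE => -[/=]; rewrite in_itv /= => /andP[tau0 tauT] zr'.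
have PT : Phi (T, 0) = w x + d.
  by rewrite /Phi /= addr0 -(scale0r (0 : X)) dotvZl mul0r mulr0 subr0 /d; ring.
have PTle : w x + d <= Phi (tau, z) by rewrite -PT; apply: Pmax; rewrite ?T0 ?lexx ?normr0 ?ltW.
have taup : 0 < tau.
  rewrite lt_neqAle tau0 andbT; apply/eqP => tauE; move: PTle; rewrite leNgt => /negP; apply.
  rewrite /Phi /= -tauE scale0r addr0 mulr0 subr0.
  apply: le_lt_trans (wr1 z _); first by rewrite gerBl mulr_ge0 ?dotv_sq_ge0 // ltW.
  by apply: le_trans zr' _; rewrite ge_min lexx orbT.
have zlt : `|z| < r'.
  rewrite lt_neqAle zr' andbT; apply/eqP => zE; move: PTle; rewrite leNgt => /negP; apply.
  rewrite /Phi /d /=.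
  have h1 : 2 * B + `|s'| * T + 1 <= K * dotv z z.
    apply: le_trans (ler_wpM2l (ltW K0) (sqr_norm_le_dotv z)).
    by rewrite zE /K divfK // gt_eqF // exprn_gt0.
  have h2 : s' * (T - tau) <= `|s'| * T.
    apply: le_trans (ler_norm _) _; rewrite normrM ler_wpM2l // ger0_norm ?subr_ge0 //.
    by rewrite gerBl.
  have := wB (x + tau *: v + z); have := wB (x + T *: v); rewrite !ler_norml.
  move=> /andP[h3 _] /andP[_ h4]; rewrite mulrBr in h2; lra.
pose c := x + tau *: v; pose y := c + z.
have yc : y - c = z by rewrite /y addrC addKr.
have qv : dotv ((2 * K) *: z) v <= s.
  rewrite -yc; apply: H.
    by exists tau; rewrite ?tau0 //= -/c yc (le_trans zr') // ge_min lexx.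
  have : \forall y' \near y, `|y' - c| < r'.
    apply: (@cvgr_lt _ _ (nbhs y) _ (fun y' => `|y' - c|) `|y - c|); last by rewrite yc.
    apply: (@continuous_comp _ _ _ (fun y : X => y - c) Num.norm); last exact: norm_continuous.
    by apply: continuousB; [exact: cvg_id|exact: cst_continuous].
  apply: filterS => y' /ltW y'r; have := Pmax tau (y' - c) _ y'r.
  rewrite tau0 tauT /Phi /= -/c (addrC c (y' - c)) subrK -/y yc => /(_ isT); lra.
pose A := K * dotv v v + 1.
have A0 : 0 < A by rewrite ltr_wpDl // mulr_ge0 ?dotv_sq_ge0 // ltW.
have v0 : 0 < `|v| + 1 by rewrite ltr_wpDl.
(* Replacing (tau, z) by (tau - t, z + t v) leaves the argument of w unchanged. The three bounds
   keep the pair admissible and the second-order term t K |v|^2 below eta / 2, less than the slack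
   eta = s' - s. *)
pose t := Num.min tau (Num.min (eta / A / 2) ((r' - `|z|) / (`|v| + 1))).
have t0 : 0 < t by rewrite !lt_min taup !divr_gt0 // subr_gt0.
have [t1 t2 t3] : [/\ t <= tau, t <= eta / A / 2 & t <= (r' - `|z|) / (`|v| + 1)].
  by split; rewrite /t ?ge_min lexx ?orbT.
have tT' : 0 <= tau - t <= T.
  by rewrite subr_ge0 t1 /=; apply: le_trans tauT; rewrite gerBl ltW.
have := Pmax _ (z + t *: v) tT'; rewrite /Phi /= scalerBl.
have -> : x + (tau *: v - t *: v) + (z + t *: v) = x + tau *: v + z.
  by rewrite addrACA subrK addrAC.
rewrite !dotvDl !dotvDr !dotvZl !dotvZr (dotvC v z) => h.
have {}h : s' * (tau - t) + K * (dotv z z + t * dotv z v + (t * dotv z v + t * (t * dotv v v))) >=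
   s' * tau + K * dotv z z.
  have : `|z + t *: v| <= r'.
    apply: le_trans (ler_normD _ _) _; rewrite normrZ (gtr0_norm t0) -lerBrDl.
    rewrite ler_pdivlMr // in t3; apply: le_trans t3; rewrite ler_pM2l // lerDl.
    exact: ler01.
  by move=> /h; lra.
rewrite dotvZl in qv.
have h5 : t * s' <= t * (2 * K * dotv z v + t * (K * dotv v v)) by lra.
rewrite ler_pM2l // in h5.
have h6 : t * (K * dotv v v) <= eta / 2.
  rewrite ler_pdivlMr // in t2; rewrite ler_pdivlMr //.
  rewrite ler_pdivlMr // in t2; apply: le_trans t2.
  by rewrite mulrAC ler_wpM2l // ?mulr_ge0 // ?ltW // /A ltrDl ltr01.
by rewrite /s' in h5; lra.
Qed.

Lemma visc_sub_quadratic H c0 w y K c : visc_sub H c0 w ->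
  (\forall z \near y, w z - K * dotv (z - c) (z - c) <= w y - K * dotv (y - c) (y - c)) ->
  H y ((2 * K) *: (y - c)) <= c0.
Proof.
move=> Hw Hy; have [qC qg] := isC1_quadratic K c.
by rewrite -qg; apply: (Hw _ (fun y => K * dotv (y - c) (y - c))).
Qed.

Lemma coercive_sublevel H a : H2a H -> exists2 P, 0 < P & forall y q, H y q <= a -> `|q| <= P.
Proof.
move=> /(_ (`|a| + 1))[K HK]; exists (Num.max K 1); first by rewrite lt_max ltr01 orbT.
move=> y q Hq; rewrite leNgt; apply/negP; rewrite gt_max => /andP[Kq q1].
have q0 : 0 < `|q| by apply: lt_trans q1.
have := HK y q (ltW Kq); rewrite ler_pdivlMr // => h.
have : `|a| + 1 <= (`|a| + 1) * `|q| by rewrite ler_peMr ?ltW // addr_ge0.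
have := ler_norm a; lra.
Qed.

(** Test gradients of a subsolution lie in the sublevel set {H <= 0}, bounded by coercivity, so
    [segment_increment] applies on the segment from b to a with v = a - b, T = 1 and an arbitrary
    radius. *)
Lemma visc_sub_lipschitz H w : H2a H -> continuous w -> periodic w -> visc_sub H 0 w ->
  exists2 C, 0 < C & forall a b, `|w a - w b| <= C * `|a - b|.
Proof.
move=> Hc cw pw Hw; have [B _ wB] := periodic_bounded cw pw.
have [P P0 HP] := coercive_sublevel 0 Hc.
exists (n%:R * P + 1); first by rewrite ltr_wpDl // mulr_ge0 // ltW.
wlog suff h : / forall a b, w a - w b <= (n%:R * P + 1) * `|a - b|.
  by move=> a b; rewrite ler_norml h andbT lerNl opprB distrC h.
move=> a b; have := @segment_increment w b (a - b) 1 ((n%:R * P + 1) * `|a - b|) 1 B cw wB.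
rewrite scale1r mulr1 (addrC b (a - b)) subrK => -> // y K c _ /(visc_sub_quadratic Hw)/HP qP.
apply: le_trans (ler_norm _) _; apply: le_trans (dotv_norm_le _ _) _.
rewrite mulrA ler_wpM2r //; apply: (@le_trans _ _ (n%:R * P)); last by rewrite lerDl.
by rewrite ler_wpM2l.
Qed.

End ViscosityIncrements.

(** * Averages over the unit interval *)

Section LineAverage.
Context {R : realType}.
Implicit Types (f g h : R -> R).

(* The base point -2 leaves room for the shifts by |t| <= 1 in [avg_shift]. *)
Definition prim f (x : R) : R := (\int[lebesgue_measure]_(t in `[- 2%:R, x]) f t)%R.

Lemma is_derive_prim f (s : R) : continuous f -> - 2%:R < s -> is_derive s 1 (prim f) (f s).
Proof.
move=> cf s2.
have fi : lebesgue_measure.-integrable `[- 2%:R, s + 1] (EFin \o f).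
  apply: continuous_compact_integrable; first exact: segment_compact.
  exact: continuous_subspaceT.
have ss1 : s < s + 1 by rewrite ltrDl.
have [df Df] := continuous_FTC1_closed ss1 fi s2 (cf s).
by apply: DeriveDef; [exact: df|rewrite -derive1E; exact: Df].
Qed.

Lemma mvt_itv (F dF : R -> R) (a b : R) : a <= b ->
  (forall s, a <= s <= b -> is_derive s 1 F (dF s)) ->
  exists2 c, a <= c <= b & F b - F a = dF c * (b - a).
Proof.
move=> ab H; have [||c cab E] := @MVT_segment _ F dF a b ab.
- by move=> s; rewrite in_itv /= => /andP[/ltW sa /ltW sb]; apply: H; rewrite sa.
- apply: derivable_within_continuous => s; rewrite in_itv /= => sab.
  by have [] := H s sab.
by exists c => //; move: cab; rewrite in_itv.
Qed.

(** The integral of f over [0,1], read off a primitive so that the fundamental theorem and the mean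
    value theorem suffice to handle it. *)
Definition avg f : R := prim f 1 - prim f 0.

(** The mean value theorem for the combined primitive yields one c common to the three averages, so
    a pointwise bound on f - g - t h passes to averages at once. *)
Lemma avg_mean f g h (t : R) : continuous f -> continuous g -> continuous h ->
  exists2 c, 0 <= c <= 1 & avg f - avg g - t * avg h = f c - g c - t * h c.
Proof.
move=> cf cg ch.
have [|c c01 E] := @mvt_itv (fun s => prim f s - prim g s - t * prim h s)
  (fun s => f s - g s - t * h s) 0 1 ler01.
  move=> s /andP[s0 _]; have s2 : - 2%:R < s by lra.
  have df := is_derive_prim cf s2; have dg := is_derive_prim cg s2.
  have dh := is_derive_prim ch s2.
  apply: is_deriveB; exact: (is_deriveZ _ t).
by exists c => //; move: E; rewrite /avg subr0 mulr1 => <-; ring.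
Qed.

(** With psi(s) the integral of f over [s, s+1], the shift changes the average by psi(t) - psi(0) =
    t psi'(c), and psi'(c) = f(c+1) - f(c) is within 2 C |t| of f(1) - f(0). *)
Lemma avg_shift f (C t : R) : (forall x y, `|f x - f y| <= C * `|x - y|) -> `|t| <= 1 ->
  `|avg (fun s => f (s + t)) - avg f - t * (f 1 - f 0)| <= 2 * C * t ^+ 2.
Proof.
move=> fC t1; have cf : continuous f by apply: lipschitz_cont fC.
have [t_1 t_2] : -1 <= t /\ t <= 1 by move: t1; rewrite ler_norml => /andP[].
have cft : continuous (fun s => f (s + t)).
  by apply: (@cont_comp _ _ _ (fun s : R => s + t) f) => //; apply: cont_add; [by move=> ?; exact: cvg_id|exact: cont_cst].
have dshift (a s : R) : - 2%:R < s + a -> is_derive s 1 (fun s => prim f (s + a)) (f (s + a)).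
  move=> h; have df := is_derive_prim cf h; rewrite -[f _]mulr1.
  by apply: (@is_derive1_comp _ (prim f) (shift a)) df _; exact: is_derive_shift.
pose fs (s : R) := f (s + t); pose psi s := prim f (s + 1) - prim f s.
have E : avg fs = prim f (1 + t) - prim f t.
  pose F (s : R) : R := prim fs s - prim f (s + t).
  have dF (s : R) : 0 <= s <= 1 -> is_derive s 1 F (fs s - f (s + t)).
    move=> /andP[s0 _]; have s2 : - 2%:R < s by lra.
    have st2 : - 2%:R < s + t by lra.
    exact: (is_deriveB (is_derive_prim cft s2) (dshift t s st2)).
  have [c _] := mvt_itv ler01 dF.
  by rewrite /avg /F /fs subrr mul0r add0r; lra.
have dpsi (s : R) : -1 <= s -> is_derive s 1 psi (f (s + 1) - f s).
  move=> s1; have s2 : - 2%:R < s by lra.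
  have st2 : - 2%:R < s + 1 by lra.
  exact: (is_deriveB (dshift 1 s st2) (is_derive_prim cf s2)).
have [c [cT Ec]] : exists c, `|c| <= `|t| /\ psi t - psi 0 = (f (c + 1) - f c) * t.
  have [t0|t0] := leP 0 t.
    have [|c /andP[c0 ct] E'] := @mvt_itv psi (fun s => f (s + 1) - f s) 0 t t0.
      by move=> s /andP[s0 _]; apply: dpsi; lra.
    by exists c; rewrite !ger0_norm // E' subr0.
  have [|c /andP[c0 ct] E'] := @mvt_itv psi (fun s => f (s + 1) - f s) t 0 (ltW t0).
    by move=> s /andP[s0 _]; apply: dpsi; lra.
  exists c; rewrite ler0_norm // ltr0_norm // lerN2; split => //.
  by rewrite -opprB E' sub0r mulrN opprK.
have -> : avg (fun s => f (s + t)) - avg f - t * (f 1 - f 0) =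
    t * ((f (c + 1) - f 1) - (f c - f 0)).
  by move: Ec; rewrite -/fs E /avg /psi add0r (addrC 1 t); lra.
rewrite normrM -(real_normK (num_real t)) expr2 mulrA mulrC ler_wpM2r //.
apply: le_trans (ler_normB _ _) _.
have := fC (c + 1) 1; have := fC c 0; rewrite subr0 addrK.
have : C * `|c| <= C * `|t|.
  have := fC 1 0; rewrite subr0 normr1 mulr1 => h.
  by rewrite ler_wpM2l // (le_trans _ h).
lra.
Qed.

End LineAverage.

(** * Averages along a direction *)

Section DirectionalAverage.
Context {R : realType} {V : normedModType R}.
Implicit Types (f g : V -> R) (x y e v : V).

Definition lip f (C : R) := forall x y, `|f x - f y| <= C * `|x - y|.

Lemma lip_cont f C : lip f C -> continuous f.
Proof. exact: lipschitz_cont. Qed.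

Lemma lip_line f C x e s t : lip f C ->
  `|f (x + s *: e) - f (x + t *: e)| <= C * `|e| * `|s - t|.
Proof.
move=> fC; apply: le_trans (fC _ _) _.
by rewrite opprD addrACA subrr add0r -scalerBl normrZ (mulrC `|s - t|) mulrA.
Qed.

Lemma lip_line_cont f C x e : lip f C -> continuous (fun s : R => f (x + s *: e)).
Proof. by move=> fC; apply: lipschitz_cont => s t; exact: lip_line fC. Qed.

Definition line_avg e f x : R := avg (fun s => f (x + s *: e)).

Lemma line_avg_mean e f g h C D E x y z t : lip f C -> lip g D -> lip h E ->
  exists2 c, 0 <= c <= 1 &
    line_avg e f x - line_avg e g y - t * line_avg e h z =
    f (x + c *: e) - g (y + c *: e) - t * h (z + c *: e).
Proof.
move=> fC gD hE; apply: avg_mean; [exact: lip_line_cont fC|exact: lip_line_cont gD|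
  exact: lip_line_cont hE].
Qed.

Lemma lip0 : lip (fun _ => 0) 0.
Proof. by move=> x y; rewrite subrr normr0 mul0r. Qed.

Lemma line_avg_mean2 e f C x y : lip f C -> exists2 c, 0 <= c <= 1 &
  line_avg e f x - line_avg e f y = f (x + c *: e) - f (y + c *: e).
Proof.
move=> fC; have [c c01 H] := line_avg_mean e x y 0 0 fC fC lip0.
by exists c => //; move: H; rewrite !mul0r !subr0.
Qed.

Lemma lip_line_avg e f C : lip f C -> lip (line_avg e f) C.
Proof.
move=> fC x y; have [c _ ->] := line_avg_mean2 e x y fC.
by apply: le_trans (fC _ _) _; rewrite opprD addrACA subrr addr0.
Qed.

Lemma line_avg_near e f C x : 0 <= C -> lip f C -> `|line_avg e f x - f x| <= C * `|e|.
Proof.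
move=> C0 fC.
have lc : lip (fun _ => f x) 0 by move=> y z; rewrite subrr normr0 mul0r.
have [c c01 E] := line_avg_mean e x x x 1 fC lip0 lc.
(* This instance and the next only evaluate the averages of the constants 0 and f x. *)
have [c3 _ E3] := line_avg_mean e x x x 1 lip0 lip0 lip0.
have [c4 _ E4] := line_avg_mean e x x x 1 lc lc lc.
have -> : line_avg e f x - f x = f (x + c *: e) - f x.
  by move: E E3 E4; rewrite !mul1r; lra.
apply: le_trans (fC _ _) _; rewrite addrAC subrr add0r normrZ ler_wpM2l //.
by rewrite ler_piMl // ger0_norm; have /andP[] := c01.
Qed.

(** C and d are uniform in x so that the expansion survives averaging, and g is Lipschitz so that
    moving its base point by t v costs only O(t^2) when directions are added. *)
Definition dincr f v := exists g L, lip g L /\ exists C d, [/\ 0 <= C, 0 < d &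
  forall x t, `|t| <= d -> `|f (x + t *: v) - f x - t * g x| <= C * t ^+ 2].

Lemma dincr_line_avg e f v C0 : lip f C0 -> dincr f v -> dincr (line_avg e f) v.
Proof.
move=> fC [g [L [gL [C [d [C_ge0 d0 H]]]]]].
exists (line_avg e g), L; split; first exact: lip_line_avg.
exists C, d; split => // x t td.
have [c _ ->] := line_avg_mean e (x + t *: v) x x t fC fC gL.
by rewrite (addrAC x (t *: v)); exact: H.
Qed.

(* Averaging along e creates the derivative along e, f(x + e) - f(x), and by [dincr_line_avg]
   preserves the existing ones; averaging along each axis in turn thus yields a C^1 function. *)
Lemma dincr_line_avg_self e f C : 0 <= C -> lip f C -> dincr (line_avg e f) e.
Proof.
move=> C0 fC; exists (fun x => f (x + e) - f x), (2 * C); split.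
  move=> x y; have := fC (x + e) (y + e); have := fC x y.
  rewrite opprD addrACA subrr addr0 => h1 h2.
  rewrite [X in `|X|](_ : _ = (f (x + e) - f (y + e)) - (f x - f y)); last by ring.
  by apply: le_trans (ler_normB _ _) _; lra.
exists (2 * (C * `|e|)), 1; split => //; first by rewrite !mulr_ge0.
move=> x t t1; have := @avg_shift _ (fun s => f (x + s *: e)) (C * `|e|) t _ t1.
rewrite scale1r scale0r addr0 => H; rewrite [X in `|X|](_ : _ = avg (fun s => f (x + (s + t) *: e)) -
  avg (fun s => f (x + s *: e)) - t * (f (x + e) - f x)).
  by apply: H => s u; exact: lip_line.
congr (_ - _ - _); congr avg; apply/funext => s.
by rewrite scalerDl addrA addrAC.
Qed.

Lemma dincr0 f : dincr f 0.
Proof.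
exists (fun=> 0), 0; split; first exact: lip0.
by exists 0, 1; split => // x t _; rewrite scaler0 addr0 subrr mulr0 subr0 normr0 mul0r.
Qed.

Lemma dincrZ f v a : dincr f v -> dincr f (a *: v).
Proof.
move=> [g [L [gL [C [d [C0 d0 H]]]]]].
exists (fun x => a * g x), (`|a| * L); split.
  by move=> x y; rewrite -mulrBr normrM -mulrA ler_wpM2l.
have a1 : 0 < `|a| + 1 by rewrite ltr_wpDl.
exists (C * a ^+ 2), (d / (`|a| + 1)); split; [by rewrite mulr_ge0 ?sqr_ge0|by rewrite divr_gt0|].
move=> x t; rewrite ler_pdivlMr // => td.
rewrite scalerA mulrA (_ : C * a ^+ 2 * t ^+ 2 = C * (t * a) ^+ 2); last by ring.
by apply: H; rewrite normrM (le_trans _ td) // ler_wpM2l // lerDl.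
Qed.

Lemma dincrD f v u : dincr f v -> dincr f u -> dincr f (v + u).
Proof.
move=> [g [L [gL [C [d [C0 d0 H]]]]]] [g' [L' [gL' [C' [d' [C'0 d'0 H']]]]]].
exists (fun x => g x + g' x), (L + L'); split.
  move=> x y; rewrite opprD addrACA mulrDl.
  by apply: le_trans (ler_normD _ _) _; apply: lerD.
exists (C + C' + `|L'| * `|v|), (Num.min d d'); split.
- by rewrite !addr_ge0 // mulr_ge0.
- by rewrite lt_min d0.
move=> x t; rewrite le_min => /andP[td td'].
have h1 := H x t td; have h2 := H' (x + t *: v) t td'.
have h3 : `|t * (g' (x + t *: v) - g' x)| <= `|L'| * `|v| * t ^+ 2.
  rewrite normrM -(real_normK (num_real t)); have := gL' (x + t *: v) x.
  rewrite addrAC subrr add0r normrZ => h.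
  apply: (@le_trans _ _ (`|t| * (`|L'| * (`|t| * `|v|)))); last by rewrite le_eqVlt; apply/orP; left; apply/eqP; ring.
  by rewrite ler_wpM2l // (le_trans h) // ler_wpM2r ?mulr_ge0 // ler_norm.
rewrite scalerDr addrA [X in `|X|](_ : _ = (f (x + t *: v) - f x - t * g x) +
  (f (x + t *: v + t *: u) - f (x + t *: v) - t * g' (x + t *: v)) +
  t * (g' (x + t *: v) - g' x)); last by ring.
apply: le_trans (ler_normD _ _) _; rewrite 2!mulrDl; apply: lerD => //.
by apply: le_trans (ler_normD _ _) _; apply: lerD.
Qed.

Lemma dincr_isC1 f C : lip f C -> (forall v, dincr f v) -> isC1 f.
Proof.
move=> fC H; have /choice[g gP] := H.
have cg v : continuous (g v).
  by have [L [gL _]] := gP v; exact: (lip_cont gL).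
have Hi x v : exists C d, 0 < d /\ forall t, `|t| <= d ->
    `|f (x + t *: v) - f x - t * g v x| <= C * t ^+ 2.
  by have [L [_ [D [d [_ d0 Hd]]]]] := gP v; exists D, d; split => //; exact: Hd.
by have [] := isC1_of_incr (lip_cont fC) cg Hi.
Qed.

End DirectionalAverage.

(** * Averages over a box *)

Section BoxAverage.
Context {R : realType} {n : nat}.
Local Notation X := 'rV[R]_n.

(** Averaging successively along the edges h e_i gives the mean over x + [0,h]^n without an
    n-dimensional integral. *)
Definition box_avg_seq (h : R) (s : seq 'I_n) (f : X -> R) : X -> R :=
  foldr (fun i g => line_avg (h *: unitv R i) g) f s.

Definition box_avg h f := box_avg_seq h (enum 'I_n) f.

Lemma unitv_norm (i : 'I_n) : `|unitv R i| <= 1.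
Proof.
apply: rv_norm_le => // j; rewrite mxE eqxx /=.
by case: (j == i); rewrite /= ?normr1 ?normr0.
Qed.

Lemma lip_box_avg_seq h s f C : lip f C -> lip (box_avg_seq h s f) C.
Proof. by move=> fC; elim: s => // i s IH; exact: lip_line_avg. Qed.

Lemma box_avg_near h f C x : 0 <= h -> 0 <= C -> lip f C ->
  `|box_avg h f x - f x| <= C * h * n%:R.
Proof.
move=> h0 C0 fC; rewrite /box_avg -[n in n%:R](size_enum_ord n).
elim: (enum 'I_n) => [|i s IH]; first by rewrite subrr normr0 mulr0.
have lC := lip_box_avg_seq h s fC.
rewrite /= -natr1 mulrDr mulr1 -(subrKA (box_avg_seq h s f x)) addrC [leRHS]addrC.
rewrite [leLHS](_ : _ = `|(line_avg (h *: unitv R i) (box_avg_seq h s f) x - box_avg_seq h s f x) +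
  (box_avg_seq h s f x - f x)|); last by congr `|_|; ring.
apply: le_trans (ler_normD _ _) _; apply: lerD => //.
apply: le_trans (line_avg_near _ _ C0 lC) _; rewrite ler_wpM2l // normrZ ger0_norm //.
by rewrite ler_piMr // unitv_norm.
Qed.

Lemma box_avg_periodic h f : periodic f -> periodic (box_avg h f).
Proof.
move=> pf; rewrite /box_avg; elim: (enum 'I_n) => //= i s IH x j.
by rewrite /line_avg; congr avg; apply/funext => t; rewrite addrAC IH.
Qed.

Lemma dincr_box_avg_seq h s f C i : 0 <= C -> lip f C -> i \in s ->
  dincr (box_avg_seq h s f) (h *: unitv R i).
Proof.
move=> C0 fC; elim: s => //= j s IH; have lC := lip_box_avg_seq h s fC.
rewrite inE => /orP[/eqP <-|/IH]; first exact: dincr_line_avg_self lC.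
exact: dincr_line_avg lC.
Qed.

Lemma isC1_box_avg h f C : 0 < h -> 0 <= C -> lip f C -> isC1 (box_avg h f).
Proof.
move=> h0 C0 fC; have lC := lip_box_avg_seq h (enum 'I_n) fC.
apply: (dincr_isC1 lC) => v; rewrite [v]row_sum_delta.
elim: (index_enum _) => [|i s IH]; first by rewrite big_nil; exact: dincr0.
rewrite big_cons; apply: dincrD => //.
have -> : v 0 i *: delta_mx 0 i = (v 0 i / h) *: (h *: unitv R i).
  by rewrite scalerA divfK // gt_eqF.
by apply: dincrZ; apply: (dincr_box_avg_seq h C0 fC); rewrite mem_enum.
Qed.

(** Each line average evaluates both terms at a common displacement of length at most h, so the base
    point moves by at most n h in total. *)
Lemma box_avg_increment h f C v b r x0 : 0 <= h -> lip f C ->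
  (forall x, `|x - x0| <= r -> f (x + v) - f x <= b) -> n%:R * h <= r ->
  box_avg h f (x0 + v) - box_avg h f x0 <= b.
Proof.
move=> h0 fC H nhr; rewrite /box_avg.
suff P x : `|x - x0| + (size (enum 'I_n))%:R * h <= r ->
    box_avg_seq h (enum 'I_n) f (x + v) - box_avg_seq h (enum 'I_n) f x <= b.
  by apply: P; rewrite subrr normr0 add0r size_enum_ord.
elim: (enum 'I_n) x => [|i s IH] x /=; first by rewrite mul0r addr0; exact: H.
rewrite -natr1 mulrDl mul1r => xr; have lC := lip_box_avg_seq h s fC.
have [c /andP[c0 c1] ->] := line_avg_mean2 (h *: unitv R i) (x + v) x lC.
rewrite addrAC; apply: IH; apply: le_trans xr; rewrite addrA addrAC lerD2r.
rewrite addrAC; apply: le_trans (ler_normD _ _) _; rewrite lerD2l.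
rewrite !normrZ (ger0_norm c0) (ger0_norm h0) mulrA.
apply: (@le_trans _ _ (1 * h * 1)); last by rewrite mul1r mulr1.
by rewrite ler_pM ?mulr_ge0 ?ler_wpM2r // unitv_norm.
Qed.

End BoxAverage.

(** * Convex Hamiltonians and smooth approximate subsolutions *)

Section Hamiltonian.
Context {R : realType} {n : nat}.
Local Notation X := 'rV[R]_n.
Variable H : X -> X -> R.
Hypotheses (Hper : periodicH H) (HC1 : isC1 (fun z : X * X => H z.1 z.2))
  (Hconv : Defs.H1 H) (Hcoer : H2a H).

Definition DpH (z : X * X) : X := \row_i 'D_((0 : X, unitv R i)) (fun z : X * X => H z.1 z.2) z.

Lemma continuous_DpH : continuous DpH.
Proof. by apply: cont_row => i; exact: (HC1.2 _).2. Qed.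

Lemma continuous_Ham : continuous (fun z : X * X => H z.1 z.2).
Proof. exact: HC1.1. Qed.

Lemma convex_gradient x p q : H x p + dotv (q - p) (DpH (x, p)) <= H x q.
Proof.
pose HJ := fun z : X * X => H z.1 z.2; pose u : X * X := (0, q - p).
have D : 'D_u HJ (x, p) = dotv (q - p) (DpH (x, p)).
  have uE : u = \sum_(i < n) (q - p) 0 i *: ((0, unitv R i) : X * X).
    rewrite /u {1}[q - p]row_sum_delta; elim: (index_enum _) => [|i s IH].
      by rewrite !big_nil.
    rewrite !big_cons -IH; apply/eqP; rewrite xpair_eqE /= scaler0 addr0 eqxx /=.
    by [].
  rewrite {1}uE isC1_derive_sum //; apply: eq_bigr => i _.
  by rewrite [DpH _ _ _]mxE.
rewrite -D; apply/ler_addgt0Pr => e e0.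
have [d d0 Hd] := isC1_strict_dir (x, p) u HC1 e0.
pose t := Num.min (d / 2) 1.
have t0 : 0 < t by rewrite lt_min divr_gt0 //=.
have t1 : t <= 1 by rewrite ge_min lexx orbT.
have td : t < d.
  by apply: (@le_lt_trans _ _ (d / 2)); [rewrite ge_min lexx|rewrite ltr_pdivrMr // ltr_pMr // ltr1n].
have := Hd (x, p) t; rewrite subrr normr0 t0 td d0 => /(_ isT isT).
rewrite ler_norml => /andP[h1 _].
have t01 : 0 <= t <= 1 by rewrite (ltW t0).
have h2 := Hconv x q p t01.
have h3 : H x (t *: q + (1 - t) *: p) = HJ ((x, p) + t *: u).
  rewrite /HJ /= scaler0 addr0; congr (H x _).
  by rewrite scalerBl scale1r scalerBr addrCA.
rewrite h3 in h2; rewrite -(ler_pM2l t0).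
move: h1 h2; rewrite /HJ /=; nra.
Qed.

(** The Fenchel equality: by the tangent inequality the supremum is attained at p. *)
Lemma Lagr_DpH x p : Lagr H x (DpH (x, p)) = (dotv p (DpH (x, p)) - H x p)%:E.
Proof.
apply/eqP; rewrite eq_le; apply/andP; split; last by apply: ereal_sup_ubound; exists p.
apply: ge_ereal_sup => _ [q _ <-]; rewrite lee_fin.
have := convex_gradient x p q; rewrite dotvDl -scaleN1r dotvZl; lra.
Qed.

Lemma Lagr_fracv x v : Lagr H (fracv x) v = Lagr H x v.
Proof.
congr ereal_sup; apply/seteqP; split => _ [p _ <-]; exists p => //.
  by rewrite (periodic_fracv (Hper p)).
by rewrite (periodic_fracv (Hper p)).
Qed.

(** Compactness gives the modulus for x in the cube; in general x and y are translated by the same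
    integer vector, so y is free to leave the cube. *)
Lemma Ham_modulus P e : 0 < e -> exists2 r, 0 < r & forall x y q, `|y - x| <= r -> `|q| <= P ->
  `|H x q - H y q| <= e.
Proof.
move=> e0.
have cK : compact (@cube R n `*` [set q : X | `|q| <= P]).
  exact: (compact_setX (@compact_cube R n) (@compact_closed_norm_ball _ _ P)).
have /compact_near_coveringP/(_ R (0^'+)
  (fun r z => forall y, `|y - z.1| <= r -> `|H z.1 z.2 - H y z.2| <= e)) := cK.
case=> [z _|d /= d0 Hd].
  have e2 : 0 < e / 2 by rewrite divr_gt0.
  have cz : {for z, continuous (fun z : X * X => H z.1 z.2)} by exact: continuous_Ham.
  have /cvgrPdist_le/(_ _ e2)/nbhs_ballP[d /= d0 Hd] := cz.
  have d2 : 0 < d / 2 by rewrite divr_gt0.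
  exists (ball z (d / 2), [set r | 0 < r < d / 2]) => /=.
    split; first exact: nbhsx_ballx.
    near=> r; rewrite /=; apply/andP; split; near: r; [exact: nbhs_right_gt|exact: nbhs_right_lt].
  move=> [z' r] [/= z'z /andP[r0 rd]] y yr.
  have h1 : `|H z.1 z.2 - H z'.1 z'.2| <= e / 2.
    by apply: Hd; apply: le_ball z'z; rewrite ler_pdivrMr // ler_pMr // ler1n.
  have h2 : `|H z.1 z.2 - H y z'.2| <= e / 2.
    apply: (Hd (y, z'.2)); rewrite [d](splitr d); apply: (ball_triangle z'z).
    rewrite -ball_normE /=; apply: (@le_lt_trans _ _ r) => //.
    by rewrite prod_normE /= subrr normr0 max_l // distrC.
  move: h1 h2; rewrite !ler_norml => /andP[? ?] /andP[? ?]; apply/andP; split; lra.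
have d2 : 0 < d / 2 by rewrite divr_gt0.
have bd : ball 0 d (d / 2).
  by rewrite -ball_normE /= sub0r normrN gtr0_norm // ltr_pdivrMr // ltr_pMr // ltr1n.
exists (d / 2) => //; have HK := Hd (d / 2) bd d2.
move=> x y q yx qP.
have := HK (fracv x, q); rewrite /= => /(_ (conj (fracv_cube x) qP) (y - floorv x)).
rewrite (periodic_fracv (Hper q)).
have -> : H (y - floorv x) q = H y q.
  have -> : - floorv x = \row_i (- Num.floor (x 0 i))%:~R by apply/rowP => i; rewrite !mxE mulrNz.
  exact: (periodic_shift _ (Hper q)).
apply; rewrite /fracv opprB addrA subrK //.
Unshelve. all: by end_near. Qed.

Lemma grad_dotv (f : X -> R) x v : isC1 f -> 'D_v f x = dotv v (grad f x).
Proof.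
move=> fC; rewrite {1}[v]row_sum_delta isC1_derive_sum //.
by apply: eq_bigr => i _; rewrite mxE.
Qed.

(** Suppose D = Dpsi(x0) has H(x0,D) > d, and let v = D_pH(x0,D). By convexity and the modulus of H,
    every q with H(y,q) <= 0 and y near x0 satisfies q.v <= D.v - d/2. This integrates to increments
    of w along v and passes to the average psi, contradicting that psi has slope D.v along v. The
    argument replaces Jensen's inequality for the gradient. *)
Lemma smooth_subsolution w d : continuous w -> periodic w -> visc_sub H 0 w -> 0 < d ->
  exists psi, [/\ isC1 psi, periodic psi, forall x, `|psi x - w x| <= d &
    forall x, H x (grad psi x) <= d].
Proof.
move=> cw pw Hw d0; have [C C0 wC] := visc_sub_lipschitz Hcoer cw pw Hw.
have [B _ wB] := periodic_bounded cw pw.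
have [P P0 HP] := coercive_sublevel 0 Hcoer.
have d2 : 0 < d / 2 by rewrite divr_gt0.
have [r r0 Hr] := Ham_modulus P d2.
pose m : R := n%:R + 1; have m0 : 0 < m by rewrite ltr_wpDl.
(* The second bound keeps psi within d of w. The first confines the averaging to r/4 around x0; the
   segment along v and the test ball take another r/4 each, so every test point stays within r of
   x0. *)
pose h := Num.min (r / 4 / m) (d / C / m).
have h0 : 0 < h by rewrite lt_min !divr_gt0.
have nh a : 0 < a -> h <= a / m -> n%:R * h <= a.
  move=> a0; rewrite ler_pdivlMr // => ha; apply: le_trans ha.
  by rewrite mulrC ler_pM2l // lerDl.
have hr : n%:R * h <= r / 4 by apply: nh; [rewrite divr_gt0|rewrite ge_min lexx].
have hd : n%:R * h <= d / C by apply: nh; [rewrite divr_gt0|rewrite ge_min lexx orbT].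
have pC := isC1_box_avg h0 (ltW C0) wC.
exists (box_avg h w); split => //.
- exact: box_avg_periodic.
- move=> x; apply: le_trans (box_avg_near x (ltW h0) (ltW C0) wC) _.
  by rewrite ler_pdivlMr // in hd; apply: le_trans hd; rewrite le_eqVlt; apply/orP; left; apply/eqP; ring.
move=> x0; set D := grad _ x0; rewrite leNgt; apply/negP => HD.
set v := DpH (x0, D).
have Hq y q : `|y - x0| <= r -> H y q <= 0 -> dotv q v <= dotv D v - d / 2.
  move=> yr Hyq; have := Hr x0 y q yr (HP _ _ Hyq).
  have := convex_gradient x0 D q; rewrite -/v dotvDl -scaleN1r dotvZl ler_norml.
  by move=> h1 /andP[_ h2]; lra.
have d4 : 0 < d / 4 by rewrite divr_gt0.
have [rho rho0 Hrho] := isC1_strict_dir x0 v pC d4.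
have v1 : 0 < `|v| + 1 by rewrite ltr_wpDl.
pose T := Num.min (rho / 2) (r / 4 / (`|v| + 1)).
have T0 : 0 < T by rewrite lt_min !divr_gt0.
have Trho : T < rho.
  by apply: (@le_lt_trans _ _ (rho / 2)); [rewrite ge_min lexx|rewrite ltr_pdivrMr // ltr_pMr // ltr1n].
have Tv t : 0 <= t <= T -> `|t *: v| <= r / 4.
  move=> /andP[t0 tT]; rewrite normrZ ger0_norm //.
  have : T <= r / 4 / (`|v| + 1) by rewrite ge_min lexx orbT.
  rewrite ler_pdivlMr // => h1; apply: le_trans h1.
  by rewrite ler_pM // lerDl.
have inc x : `|x - x0| <= r / 4 -> w (x + T *: v) - w x <= (dotv D v - d / 2) * T.
  move=> xr; have r4 : 0 < r / 4 by rewrite divr_gt0.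
  apply: (segment_increment cw wB (ltW T0) r4) => y K c [tau tauT ytau] test.
  apply: (Hq y); last exact: visc_sub_quadratic test.
  rewrite [y - x0](_ : _ = (y - (x + tau *: v)) + tau *: v + (x - x0)); last first.
    have -> : y - (x + tau *: v) + tau *: v = y - x by rewrite opprD addrA subrK.
    by rewrite addrA subrK.
  apply: le_trans (ler_normD _ _) _; have := ler_normD (y - (x + tau *: v)) (tau *: v).
  by have := Tv _ tauT; lra.
have := box_avg_increment (ltW h0) wC inc hr.
have := Hrho x0 T; rewrite subrr normr0 rho0 T0 Trho => /(_ isT isT).
rewrite (grad_dotv _ _ pC) -/D dotvC ler_norml => /andP[h1 _] h2.
have : 0 < d / 4 * T by rewrite mulr_gt0.
by move: h1 h2; rewrite mulrBl; lra.
Qed.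

End Hamiltonian.

(** * Linear combinations and gradients of C^1 functions *)

Section C1Functions.
Context {R : realType} {n : nat}.
Local Notation X := 'rV[R]_n.

Lemma isC1_lin (V : normedModType R) (f g : V -> R) (a b : R) : isC1 f -> isC1 g ->
  isC1 (fun x => a * f x + b * g x) /\
  forall x v, 'D_v (fun x => a * f x + b * g x) x = a * 'D_v f x + b * 'D_v g x.
Proof.
move=> [cf df] [cg dg].
have isd x v : is_derive x v (fun x => a * f x + b * g x) (a * 'D_v f x + b * 'D_v g x).
  have h1 : is_derive x v f ('D_v f x) by apply: DeriveDef => //; exact: (df v).1.
  have h2 : is_derive x v g ('D_v g x) by apply: DeriveDef => //; exact: (dg v).1.
  exact: (is_deriveD (is_deriveZ a h1) (is_deriveZ b h2)).
have D x v : 'D_v (fun x => a * f x + b * g x) x = a * 'D_v f x + b * 'D_v g x.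
  by have [] := isd x v.
split => //; split.
  by apply: cont_add; apply: cont_mul => //; exact: cont_cst.
move=> v; split; first by move=> x; have [] := isd x v.
rewrite (_ : 'D_v _ = fun x => a * 'D_v f x + b * 'D_v g x); last by apply/funext => x.
by apply: cont_add; apply: cont_mul; [exact: cont_cst|exact: (df v).2|exact: cont_cst|exact: (dg v).2].
Qed.

Lemma grad_lin (f g : X -> R) (a b : R) x : isC1 f -> isC1 g ->
  grad (fun x => a * f x + b * g x) x = a *: grad f x + b *: grad g x.
Proof.
by move=> fC gC; apply/rowP => i; rewrite !mxE (isC1_lin a b fC gC).2.
Qed.

Lemma isC1_0 : isC1 (fun _ : X => 0 : R) /\ forall x, grad (fun _ : X => 0 : R) x = 0.
Proof.
have D v x : 'D_v (fun _ : X => 0 : R) x = 0 by exact: derive_cst.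
split; last by move=> x; apply/rowP => i; rewrite !mxE D.
split; first exact: cont_cst.
move=> v; split; first by move=> x; exact: derivable_cst.
by rewrite (_ : 'D_v _ = fun=> 0); [exact: cont_cst|apply/funext => x].
Qed.

Lemma cont_grad (f : X -> R) : isC1 f -> continuous (grad f).
Proof. by move=> fC; apply: cont_row => i; exact: (fC.2 _).2. Qed.

Lemma grad_periodic (f : X -> R) : periodic f -> periodic (grad f).
Proof.
move=> pf x i; apply/rowP => j; rewrite !mxE /derive.
rewrite (_ : (fun h : R => h^-1 *: ((f \o shift (x + unitv R i)) (h *: unitv R j) - f (x + unitv R i))) =
  (fun h => h^-1 *: ((f \o shift x) (h *: unitv R j) - f x))) //.
by apply/funext => h /=; rewrite addrA !pf.
Qed.

End C1Functions.

(** * The dual problem and its measure *)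

Section Duality.
Context {R : realType} {n : nat}.
Local Notation X := 'rV[R]_n.
Variable H : X -> X -> R.
Hypotheses (Hper : periodicH H) (HC1 : isC1 (fun z : X * X => H z.1 z.2))
  (Hconv : Defs.H1 H) (Hcoer : H2a H).
Variables (w1 w2 : X -> R) (M : R) (xM : X).
Hypotheses (cw1 : continuous w1) (pw1 : periodic w1) (sub1 : visc_sub H 0 w1).
Hypotheses (cw2 : continuous w2) (pw2 : periodic w2) (super2 : visc_super H 0 w2).
Hypothesis HxM : w1 xM - w2 xM = M.

(* [hol phi] and [lag] are v.Dphi(x) and L(x,v) pulled back by v = D_pH(x,p). *)
Definition hol (phi : X -> R) (z : X * X) : R := dotv (DpH H z) (grad phi z.1).
Definition lag (z : X * X) : R := dotv z.2 (DpH H z) - H z.1 z.2.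
Definition gap (z : X * X) : R := w1 z.1 - w2 z.1 - M.

Lemma cont_fst : continuous (fun z : X * X => z.1). Proof. by move=> z; exact: cvg_fst. Qed.
Lemma cont_snd : continuous (fun z : X * X => z.2). Proof. by move=> z; exact: cvg_snd. Qed.

Lemma cont_hol phi : isC1 phi -> continuous (hol phi).
Proof.
move=> pC; apply: cont_dotv; first exact: continuous_DpH.
exact: (cont_comp cont_fst (cont_grad pC)).
Qed.

Lemma cont_lag : continuous lag.
Proof.
apply: cont_sub; last exact: continuous_Ham.
by apply: cont_dotv; [exact: cont_snd|exact: continuous_DpH].
Qed.

Lemma cont_gap : continuous gap.
Proof.
apply: cont_sub; last exact: cont_cst.
by apply: cont_sub; [exact: (cont_comp cont_fst cw1)|exact: (cont_comp cont_fst cw2)].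
Qed.

(* If the conclusion failed, perturbing a smooth approximate subsolution psi near w1 to
   u = (1 - t a) psi - t phi would violate the supersolution test of w2 at a minimum of w2 - u. *)
Lemma dual_cone_ge0 P1 phi a b c :
  (forall y q, H y q <= 1 -> `|q| <= P1) ->
  isC1 phi -> periodic phi -> 0 <= a -> 0 <= b ->
  (forall z, cube z.1 -> `|z.2| <= P1 + 1 -> - hol phi z - a * lag z + b * gap z <= c) ->
  0 <= c.
Proof.
move=> HP1 phiC pphi a0 b0 Hc; rewrite leNgt; apply/negP => c0.
pose e := - c; have e0 : 0 < e by rewrite oppr_gt0.
have [G G0 HG] : exists2 G, 0 <= G & forall x, `|grad phi x| <= G.
  have cn : continuous (fun x => `|grad phi x|).
    by apply: (cont_comp (cont_grad phiC)); exact: norm_continuous.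
  have [G G0 HG] := periodic_bounded cn
    (fun x i => congr1 Num.norm (grad_periodic pphi x i)).
  by exists G => // x; have := HG x; rewrite normr_id.
have [Bphi Bphi0 HBphi] := periodic_bounded phiC.1 pphi.
have [B1 B10 HB1] := periodic_bounded cw1 pw1.
pose C := 2 * (a * (B1 + 1) + Bphi).
have C0 : 0 <= C by rewrite mulr_ge0 // addr_ge0 // mulr_ge0 // addr_ge0.
(* These bounds give t a <= 1, so that psi keeps a nonnegative coefficient; t G <= 1, so that |Du|
   <= P1 + 1; and t b C <= e/4, which limits the loss in b g. *)
pose t := Num.min (a + 1)^-1 (Num.min (G + 1)^-1 (e / 4 / (b * C + 1))).
have t0 : 0 < t.
  by rewrite !lt_min !invr_gt0 !divr_gt0 ?ltr_wpDl // mulr_ge0.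
have ta : t * a <= 1.
  have h : t <= (a + 1)^-1 by rewrite ge_min lexx.
  apply: le_trans (ler_wpM2r a0 h) _.
  by rewrite mulrC ler_pdivrMr ?ltr_wpDl // mul1r lerDl.
have tG : t * G <= 1.
  have h : t <= (G + 1)^-1 by rewrite !ge_min lexx orbT.
  apply: le_trans (ler_wpM2r G0 h) _.
  by rewrite mulrC ler_pdivrMr ?ltr_wpDl // mul1r lerDl.
have tbC : t * (b * C) <= e / 4.
  have h : t <= e / 4 / (b * C + 1) by rewrite !ge_min lexx !orbT.
  have bC : 0 <= b * C by rewrite mulr_ge0.
  rewrite ler_pdivlMr ?ltr_wpDl // in h; apply: le_trans h.
  by rewrite ler_pM2l // lerDl.
(* The final inequality is multiplied by t but the convexity error d is not, so d is chosen after t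
   and small against t e; d <= 1 brings Dpsi under the bound P1. *)
pose d := Num.min 1 (Num.min (t * e / 4) (e / 8 / (b + 1))).
have d0 : 0 < d by rewrite !lt_min ltr01 !divr_gt0 ?mulr_gt0 ?ltr_wpDl.
have d1 : d <= 1 by rewrite ge_min lexx.
have d2 : d <= t * e / 4 by rewrite !ge_min lexx orbT.
have d3 : 2 * b * d <= e / 4.
  have h : d <= e / 8 / (b + 1) by rewrite !ge_min lexx !orbT.
  rewrite ler_pdivlMr ?ltr_wpDl // in h.
  by move: h; rewrite mulrDr; lra.
have [psi [psiC ppsi psiw Hpsi]] := smooth_subsolution Hper HC1 Hconv Hcoer cw1 pw1 sub1 d0.
pose u x := (1 - t * a) * psi x + (- t) * phi x.
have [uC _] := isC1_lin (1 - t * a) (- t) psiC phiC; rewrite -/u in uC.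
have pu : periodic (fun x => u x - w2 x) by move=> x i; rewrite /u ppsi pphi pw2.
have [y ycube ymax] := periodic_max (cont_sub uC.1 cw2) pu.
have Hy : 0 <= H y (grad u y).
  have nmin : \forall x \near y, w2 y - u y <= w2 x - u x.
    by apply: (@filterE _ (nbhs y) (nbhs_filter y)) => x; have := ymax x; lra.
  exact: super2 uC nmin.
have := @grad_lin _ _ psi phi (1 - t * a) (- t) y psiC phiC; rewrite -/u => gradu.
set q := grad u y in Hy gradu; set D1 := grad psi y in gradu; set gp := grad phi y in gradu.
have HD1 : H y D1 <= d by exact: Hpsi.
have D1P : `|D1| <= P1 by apply: (HP1 y); exact: le_trans d1.
have ta0 : 0 <= 1 - t * a by rewrite subr_ge0.
have qP : `|q| <= P1 + 1.
  rewrite gradu; apply: le_trans (ler_normD _ _) _.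
  rewrite !normrZ normrN (gtr0_norm t0) (ger0_norm ta0); apply: lerD.
    apply: le_trans D1P; rewrite ler_piMl // gerBl mulr_ge0 // ltW //.
  by apply: le_trans tG; rewrite ler_pM2l // HG.
have := Hc (y, q) ycube qP; rewrite /hol /lag /gap /=.
set v := DpH H (y, q) => hc.
have hconv := convex_gradient HC1 Hconv y q D1; rewrite -/v in hconv.
have qv : dotv q v = (1 - t * a) * dotv D1 v - t * dotv v gp.
  by rewrite gradu dotvDl !dotvZl (dotvC gp) mulNr.
have hA : dotv (D1 - q) v = dotv D1 v - dotv q v.
  by rewrite dotvDl -scaleN1r dotvZl mulN1r.
rewrite hA in hconv.
(* Since u is uniformly within d + t C / 2 of w1 and y maximizes u - w2, comparison with xM shows
   that y almost maximizes w1 - w2. *)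
have gy : - (2 * d + t * C) <= w1 y - w2 y - M.
  have near_u x : `|w1 x - u x| <= d + t * (a * (B1 + 1) + Bphi).
    have h1 := psiw x; have h2 := HB1 x; have h3 := HBphi x.
    have h4 : `|psi x| <= B1 + 1.
      rewrite -(subrK (w1 x) (psi x)) addrC; apply: le_trans (ler_normD _ _) _.
      by rewrite lerD // (le_trans h1).
    rewrite (_ : w1 x - u x = - (psi x - w1 x) + t * (a * psi x + phi x)); last by rewrite /u; ring.
    apply: le_trans (ler_normD _ _) _; rewrite normrN lerD // normrM (gtr0_norm t0) ler_pM2l //.
    by apply: le_trans (ler_normD _ _) _; rewrite normrM (ger0_norm a0) lerD // ler_wpM2l.
  have := near_u y; have := near_u xM; have := ymax xM; rewrite !ler_norml /C.
  by move=> h1 /andP[h2 h3] /andP[h4 h5]; move: HxM; lra.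
have htc : t * (- dotv v gp - a * (dotv q v - H y q) + b * (w1 y - w2 y - M)) <= t * c.
  by rewrite ler_pM2l.
have hbg : - (t * b * (2 * d + t * C)) <= t * b * (w1 y - w2 y - M).
  by rewrite -mulrN ler_wpM2l // mulr_ge0 // ltW.
have htaH : 0 <= t * a * H y q by rewrite !mulr_ge0 // ltW.
pose A := dotv q v - dotv D1 v.
have hA2 : - d <= A by rewrite /A; lra.
have hA3 : - d <= (1 - t * a) * A.
  have : (1 - t * a) * - d <= (1 - t * a) * A by rewrite ler_wpM2l.
  have : 0 <= t * a * d by rewrite !mulr_ge0 // ltW.
  rewrite mulrBl mul1r; lra.
(* Substituting Du = (1 - t a) Dpsi - t Dphi eliminates phi; both remaining terms are bounded below,
   by - d and by 0. *)
have key : t * (- dotv v gp - a * (dotv q v - H y q)) = (1 - t * a) * A + t * a * H y q.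
  have : t * dotv v gp = (1 - t * a) * dotv D1 v - dotv q v by rewrite qv; ring.
  rewrite /A mulrBr mulrN => ->; ring.
have ht1 : t * (2 * b * d) <= t * (e / 4) by rewrite ler_pM2l.
have ht2 : t * (t * (b * C)) <= t * (e / 4) by rewrite ler_pM2l.
have hte : 0 < t * e by rewrite mulr_gt0.
rewrite mulrDr key in htc; move: htc hbg hA3 htaH ht1 ht2 hte d2; rewrite /e.
rewrite (_ : t * b * (2 * d + t * C) = t * (2 * b * d) + t * (t * (b * C))); last by ring.
rewrite (_ : t * (b * (w1 y - w2 y - M)) = t * b * (w1 y - w2 y - M)); last by ring.
by rewrite !mulrN !mulNr; lra.
Qed.

Theorem exists_dual_measure : exists Q : probability (phase R n) R,
  [/\ forall f : X * X -> R, continuous f -> Q.-integrable setT (EFin \o f),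
      forall phi, isC1 phi -> periodic phi -> (\int[Q]_z (hol phi z)%:E = 0)%E,
      (\int[Q]_z (lag z)%:E <= 0)%E & (0 <= \int[Q]_z (gap z)%:E)%E].
Proof.
have [P1 P10 HP1] := coercive_sublevel 1 Hcoer.
(* P1 bounds the gradients of approximate subsolutions, and the extra 1 makes room for the
   perturbation t Dphi in [dual_cone_ge0]. *)
pose K : set (X * X) := @cube R n `*` [set q : X | `|q| <= P1 + 1].
have cK : compact K.
  exact: (compact_setX (@compact_cube R n) (@compact_closed_norm_ball _ _ (P1 + 1))).
pose E (f : X * X -> R) := [set c : R | exists phi a b, [/\ isC1 phi, periodic phi, 0 <= a, 0 <= b &
  forall z, K z -> f z - hol phi z - a * lag z + b * gap z <= c]].
have [zC zg] := @isC1_0 R n.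
have hol0 z : hol (fun=> 0) z = 0 by rewrite /hol zg -(scale0r 0) dotvZr mul0r.
have E0 f c : (forall z, K z -> f z <= c) -> E f c.
  move=> fc; exists (fun=> 0), 0, 0; split => // z Kz.
  by rewrite hol0 subr0 !mul0r subr0 addr0; exact: fc.
have Kbd (f : X * X -> R) : continuous f -> exists B : R, forall z, K z -> `|f z| <= B.
  move=> cf; have K0 : K !=set0.
    exists (0, 0); split=> /=; first by move=> i; rewrite mxE lexx ler01.
    by rewrite normr0 addr_ge0 // ltW.
  have [z _ Hz] := compact_EVT_max K0 cK (continuous_subspaceT (cont_abs cf)).
  by exists `|f z| => z' Kz'; apply: Hz; rewrite inE.
(* Since f >= - B on K, a value c admissible for f makes c + B admissible for 0, hence
   nonnegative. *)
have Elb f B : (forall z, K z -> `|f z| <= B) -> lbound (E f) (- B).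
  move=> fB c [phi [a [b [phiC pphi a0 b0 Hc]]]].
  rewrite -subr_ge0 opprK; apply: (dual_cone_ge0 HP1 phiC pphi a0 b0) => z z1 z2.
  have Kz : K z by split.
  by have := Hc z Kz; have := fB z Kz; rewrite ler_norml => /andP[h1 h2]; lra.
pose D : set (X * X -> R) := [set f | continuous f].
have Einf f : D f -> has_inf (E f).
  move=> /Kbd[B fB]; split; last by exists (- B); exact: Elb.
  by exists B; apply: E0 => z Kz; apply: le_trans (ler_norm _) (fB z Kz).
have inf_le f c : D f -> E f c -> inf (E f) <= c.
  by move=> Df Ec; apply: ge_inf => //; have [] := Einf f Df.
have [L [LD LZ Lle]] : exists L : (X * X -> R) -> R,
  [/\ forall f g, D f -> D g -> L (f + g) = L f + L g,
      forall t f, D f -> L (t *: f) = t * L f &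
      forall f, D f -> L f <= inf (E f)].
  have DD f g : D f -> D g -> D (f + g) by move=> cf cg; exact: cont_add.
  have DZ (t : R) f : D f -> D (t *: f).
    by move=> cf; apply: (@cont_mul _ _ (fun=> t)) => //; exact: cont_cst.
  apply: (hahn_banach _ DD DZ); first exact: (@cont_cst _ _ 0).
  split=> [f g Df Dg|t f t0 Df].
    apply/ler_addgt0Pl => e e0; have e20 : 0 < e / 2 by rewrite divr_gt0.
    have [c [phi [a [b [phiC pphi a0 b0 Hc]]]] hc] := inf_adherent e20 (Einf f Df).
    have [c' [phi' [a' [b' [phiC' pphi' a0' b0' Hc']]]] hc'] := inf_adherent e20 (Einf g Dg).
    apply: (@le_trans _ _ (c + c')); last by lra.
    apply: inf_le; first exact: DD.
    exists (fun x => 1 * phi x + 1 * phi' x), (a + a'), (b + b').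
    split; rewrite ?addr_ge0 //; first by have [] := isC1_lin 1 1 phiC phiC'.
      by move=> x i; rewrite pphi pphi'.
    move=> z Kz; have := Hc z Kz; have := Hc' z Kz.
    have -> : hol (fun x => 1 * phi x + 1 * phi' x) z = hol phi z + hol phi' z.
      by rewrite /hol grad_lin // dotvDr !dotvZr !mul1r.
    have -> : (f + g) z = f z + g z by [].
    rewrite !mulrDl; lra.
  rewrite -ler_pdivrMl //; apply: lb_le_inf; first by have [] := Einf f Df.
  move=> c [phi [a [b [phiC pphi a0 b0 Hc]]]]; rewrite ler_pdivrMl //.
  apply: inf_le; first exact: DZ.
  (* The multiple t phi is written as a two-term combination to fit [isC1_lin] and [grad_lin]. *)
  exists (fun x => t * phi x + 0 * phi x), (t * a), (t * b).
  split; rewrite ?mulr_ge0 // ?(ltW t0) //; first by have [] := isC1_lin t 0 phiC phiC.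
    by move=> x i; rewrite pphi.
  move=> z Kz; have -> : hol (fun x => t * phi x + 0 * phi x) z = t * hol phi z.
    by rewrite /hol grad_lin // dotvDr !dotvZr mul0r addr0.
  have := Hc z Kz; rewrite -(ler_pM2l t0).
  have -> : (t *: f) z = t * f z by [].
  lra.
(* Each property of the measure follows from multipliers that cancel the function at c = 0: phi
   itself for [hol phi], a = 1 for [lag], b = 1 for the opposite of [gap]. Holonomy becomes an
   equality on passing to - phi. *)
have L0 f : D f -> E f 0 -> L f <= 0.
  by move=> Df Ef; apply: le_trans (Lle f Df) _; exact: inf_le.
have [Q HQ] := riesz_representation cK LD LZ
  (fun f c cf fc => le_trans (Lle f cf) (inf_le f c cf (E0 f c fc))).
exists Q; split.
- by move=> f cf; have [] := HQ f cf.
- move=> phi phiC pphi; have [_ ->] := HQ _ (cont_hol phiC).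
  have LN psi : isC1 psi -> periodic psi -> L (hol psi) <= 0.
    move=> psiC ppsi; apply: L0; first exact: cont_hol.
    by exists psi, 0, 0; split => // z _; rewrite subrr !mul0r subr0 addr0.
  congr EFin; apply/eqP; rewrite eq_le LN //=.
  have := LN (fun x => -1 * phi x + 0 * phi x) (isC1_lin (-1) 0 phiC phiC).1.
  have -> : hol (fun x => -1 * phi x + 0 * phi x) = -1 *: hol phi.
    apply/funext => z; rewrite /hol grad_lin // dotvDr !dotvZr mul0r addr0.
    by [].
  rewrite LZ; last exact: cont_hol.
  by rewrite mulN1r oppr_le0; apply => x i; rewrite pphi.
- have [_ ->] := HQ _ cont_lag; rewrite lee_fin; apply: L0; first exact: cont_lag.
  by exists (fun=> 0), 1, 0; split => // z _; rewrite hol0 mul1r mul0r subr0 addr0 subrr.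
have [_ ->] := HQ _ cont_gap; rewrite lee_fin -oppr_le0 -mulN1r -LZ; last exact: cont_gap.
apply: L0; first by apply: (@cont_mul _ _ (fun=> -1)) => //; [exact: cont_cst|exact: cont_gap].
exists (fun=> 0), 0, 1; split => // z _; rewrite hol0 mul0r mul1r !subr0.
have -> : (-1 *: gap) z = -1 * gap z by [].
by rewrite mulN1r addNr.
Qed.

End Duality.

(** * Push-forward to the torus and Mather measures *)

Lemma cont_pair (T U W : topologicalType) (f : T -> U) (g : T -> W) :
  continuous f -> continuous g -> continuous (fun t => (f t, g t)).
Proof. by move=> cf cg t; exact: (cvg_pair (cf t) (cg t)). Qed.

(** Positive and negative parts are compared separately because g, later the Lagrangian under a
    holonomic measure, may have infinite integral. *)
Lemma le_integral_integrable_lower d (T : measurableType d) (R : realType)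
  (mu : {measure set T -> \bar R}) (h g : T -> \bar R) :
  mu.-integrable setT h -> measurable_fun setT g -> (forall x, h x <= g x)%E ->
  (\int[mu]_x h x <= \int[mu]_x g x)%E.
Proof.
move=> ih mg hg; have mh := measurable_int mu ih.
rewrite [leLHS]integralE [leRHS]integralE; apply: leeB; apply: ge0_le_integral => //.
- exact: measurable_funepos.
- exact: measurable_funepos.
- by move=> x _; apply: (@funepos_le _ _ setT) => //; rewrite inE.
- exact: measurable_funeneg.
- exact: measurable_funeneg.
- by move=> x _; apply: (@funeneg_le _ _ setT) => //; rewrite inE.
Qed.

Section MatherMeasure.
Context {R : realType} {n : nat}.
Local Notation X := 'rV[R]_n.
Variable H : X -> X -> R.
Hypotheses (Hper : periodicH H) (HC1 : isC1 (fun z : X * X => H z.1 z.2))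
  (Hconv : Defs.H1 H) (Hcoer : H2a H).

Lemma measurable_cont_phase (f : X * X -> R) : continuous f ->
  measurable_fun setT (f : phase R n -> R).
Proof. exact: measurable_cont. Qed.

Lemma open_phase_measurable (U : set (X * X)) : open U -> measurable (U : set (phase R n)).
Proof. by move=> oU; apply: sub_sigma_algebra. Qed.

(** A supremum of continuous functions is lower semicontinuous: its strict superlevel sets are
    unions of open sets, even though the supremum is uncountable. *)
Lemma measurable_Lagr : measurable_fun setT (fun z : phase R n => Lagr H z.1 z.2).
Proof.
apply: (measurability _ (ErealGenOInfty.measurableE R)) => _ [_ [r ->] <-].
rewrite setTI; apply: open_phase_measurable.
have -> : (fun z : X * X => Lagr H z.1 z.2) @^-1` `]r%:E, +oo[%classic =
    \bigcup_(p in [set: X]) [set z : X * X | r < dotv p z.2 - H z.1 p].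
  apply/seteqP; split => z /=.
    rewrite in_itv /= andbT => /ereal_sup_gt[_ [p _ <-]]; rewrite lte_fin => h.
    by exists p.
  move=> [p _ /= h]; rewrite in_itv /= andbT; apply: (@lt_le_trans _ _ (dotv p z.2 - H z.1 p)%:E).
    by rewrite lte_fin.
  by apply: ereal_sup_ubound; exists p.
apply: bigcup_open => p _.
have cf : continuous (fun z : X * X => dotv p z.2 - H z.1 p).
  apply: cont_sub.
    apply: cont_dotv; [exact: cst_continuous|exact: cont_snd].
  apply: (@cont_comp _ _ _ (fun z : X * X => (z.1, p)) (fun z => H z.1 z.2)).
    exact: (cont_pair (@cont_fst R n) (@cst_continuous _ _ p)).
  exact: continuous_Ham.
exact: (open_comp (fun z _ => cf z) (@open_gt _ r)).
Qed.

(** Positions are reduced to [0,1)^n, as [torus_supported] demands. The velocity is taken at the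
    unreduced point; by periodicity of H the Lagrangian has the same value at both positions. *)
Definition to_torus (z : phase R n) : phase R n := (fracv z.1, DpH H z).

(** The fractional part is discontinuous, but on each of the countably many integer cells it is a
    translation. *)
Lemma measurable_to_torus : measurable_fun setT to_torus.
Proof.
have mE : (@measurable _ (phase R n)) = <<s @phase_open R n >> by [].
apply: (measurability _ mE) => _ [U oU <-]; rewrite setTI.
pose k_ (k : 'rV[int]_n) : X := \row_i (k 0 i)%:~R.
have -> : to_torus @^-1` U = \bigcup_(k in [set: 'rV[int]_n])
   ((\bigcap_(i in [set: 'I_n]) (fun z : phase R n => z.1 0 i) @^-1` `[(k 0 i)%:~R, (k 0 i + 1)%:~R[%classic) `&`
    (fun z : X * X => (z.1 - k_ k, DpH H z)) @^-1` U).
  apply/seteqP; split => [z Uz|z [k _ [Hk Uk]]].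
    exists (\row_i Num.floor (z.1 0 i)) => //; split.
      by move=> i _; rewrite /= in_itv /= mxE floor_le floorD1_gt.
    rewrite /= (_ : k_ _ = floorv z.1) //.
    by apply/rowP => i; rewrite !mxE.
  rewrite /to_torus /= (_ : fracv z.1 = z.1 - k_ k) //.
  congr (_ - _); apply/rowP => i; rewrite !mxE; congr _%:~R.
  by apply: floor_def; have := Hk i I; rewrite /= in_itv.
apply: countable_bigcupT_measurable => [|k]; first exact: countableP.
apply: measurableI.
  apply: fin_bigcap_measurable => // i _; rewrite -[X in measurable X]setTI.
  apply: (@measurable_cont_phase (fun z : X * X => z.1 0 i)) => //.
  by apply: cont_coord; exact: cont_fst.
apply: open_phase_measurable; apply: open_comp => // z _.
apply: (cont_pair (f := fun z : X * X => z.1 - k_ k)); last exact: continuous_DpH.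
by move=> y; apply: continuousB; [exact: cont_fst|exact: cst_continuous].
Qed.

(** Young's inequality with p = Dpsi(x) gives L(x,v) >= v.Dpsi(x) - d for a smooth approximate
    subsolution psi, and holonomy cancels the integral of v.Dpsi. *)
Lemma action_ge0 (w : X -> R) (nu : probability (phase R n) R) :
  continuous w -> periodic w -> visc_sub H 0 w -> holonomic nu -> (0 <= action H nu)%E.
Proof.
move=> cw pw Hw [_ hnu]; apply/lee_addgt0Pr => d d0.
have [psi [psiC ppsi _ Hpsi]] := smooth_subsolution Hper HC1 Hconv Hcoer cw pw Hw d0.
have [ih Eh] := hnu psi psiC ppsi.
have id : nu.-integrable setT (cst d%:E).
  by apply: finite_measure_integrable_cst.
have -> : 0%E = (\int[nu]_z ((dotv z.2 (grad psi z.1))%:E - d%:E) + d%:E)%E.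
  rewrite integralB // Eh sub0e integral_cst //= probability_setT mule1.
  by rewrite addeC subee.
apply: leeD2r; apply: le_integral_integrable_lower.
- exact: integrableB.
- exact: measurable_Lagr.
move=> z; apply: (@le_trans _ _ (dotv (grad psi z.1) z.2 - H z.1 (grad psi z.1))%:E).
  by rewrite -EFinB lee_fin dotvC lerB.
by apply: ereal_sup_ubound; exists (grad psi z.1).
Qed.

Section PushForward.
Variable Q : probability (phase R n) R.
Hypothesis Qint : forall f : X * X -> R, continuous f -> Q.-integrable setT (EFin \o f).
Hypothesis Qhol : forall phi, isC1 phi -> periodic phi -> (\int[Q]_z (hol H phi z)%:E = 0)%E.
Hypothesis Qlag : (\int[Q]_z (lag H z)%:E <= 0)%E.

Let mto : {mfun phase R n >-> phase R n} :=
  MeasurableFun.Pack (MeasurableFun.Class (isMeasurableFun.Build _ _ _ _ _ measurable_to_torus)).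

Definition torus_measure : probability (phase R n) R := distribution Q mto.

(** Change of variables with f and g kept apart: the Lagrangian is merely measurable and
    extended-valued, while its composition with [to_torus] is the continuous function [lag]. *)
Lemma integral_torus_measure (f : phase R n -> \bar R) (g : X * X -> R) :
  measurable_fun setT f -> continuous g -> (forall z, f (to_torus z) = (g z)%:E) ->
  torus_measure.-integrable setT f /\
  (\int[torus_measure]_z f z = \int[Q]_z (g z)%:E)%E.
Proof.
move=> mf cg fg; have E : f \o to_torus = EFin \o g by apply/funext => z; exact: fg.
have iq : Q.-integrable (to_torus @^-1` setT) (f \o to_torus).
  by rewrite preimage_setT E; exact: Qint.
split; first exact: (integrable_pushforward measurable_to_torus).
have := integral_pushforward measurable_to_torus mf iq measurableT.
by rewrite preimage_setT E.
Qed.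

Lemma mather_torus_measure (w : X -> R) :
  continuous w -> periodic w -> visc_sub H 0 w -> mather H torus_measure.
Proof.
move=> cw pw Hw; split; first split.
- have E : to_torus @^-1` [set z : phase R n | forall i, 0 <= z.1 0 i < 1] = setT.
    by apply/seteqP; split => // z _ i; exact: fracv_itv.
  transitivity (Q (to_torus @^-1` [set z : phase R n | forall i, 0 <= z.1 0 i < 1])) => //.
  by rewrite E probability_setT.
- move=> phi phiC pphi; rewrite -(Qhol phiC pphi).
  apply: integral_torus_measure; last 2 first.
  + exact: cont_hol.
  + move=> z; congr EFin; rewrite /hol /to_torus /=.
    by rewrite (periodic_fracv (grad_periodic pphi)).
  apply/measurable_EFinP; apply: (@measurable_cont_phase (fun z => dotv z.2 (grad phi z.1))).
  apply: cont_dotv; first exact: cont_snd.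
  exact: (cont_comp (@cont_fst R n) (cont_grad phiC)).
move=> nu hnu; apply: (@le_trans _ _ 0%E); last exact: action_ge0 cw pw Hw hnu.
apply: le_trans Qlag; rewrite /action.
have [|||_ ->] := @integral_torus_measure (fun z => Lagr H z.1 z.2) (lag H) => //.
- exact: measurable_Lagr.
- exact: cont_lag.
by case=> x p; rewrite /to_torus /= Lagr_fracv // Lagr_DpH.
Qed.

Lemma integral_torus_base (w : X -> R) : continuous w -> periodic w ->
  (\int[torus_measure]_z (w z.1)%:E = \int[Q]_z (w z.1)%:E)%E.
Proof.
move=> cw pw; have cw1 : continuous (fun z : X * X => w z.1).
  exact: (cont_comp (@cont_fst R n) cw).
have [||_ ->] := @integral_torus_measure (fun z => (w z.1)%:E) (fun z => w z.1) _ cw1 => //.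
  by apply/measurable_EFinP; exact: measurable_cont_phase.
by move=> z; rewrite /to_torus /= (periodic_fracv pw).
Qed.

End PushForward.

End MatherMeasure.

Unset Implicit Arguments.

(** * Comparison of the two solutions *)

Theorem mainTheorem1 (R : realType) (n : nat)
  (H : 'rV[R]_n -> 'rV[R]_n -> R)
  (Hper : periodicH H) (HC2 : C2_Ham H)
  (HH1 : H1 H) (HH2a : H2a H) (HH2b : H2b H)
  (Herg : is_ergodic_constant H 0)
  (w1 w2 : 'rV[R]_n -> R)
  (sol1 : visc_sol H 0 w1) (sol2 : visc_sol H 0 w2)
  (hint : forall mu : probability (phase R n) R, mather H mu ->
     (\int[mu]_(z in [set: phase R n]) (w1 z.1)%:E
        <= \int[mu]_(z in [set: phase R n]) (w2 z.1)%:E)%E) :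
  forall x : 'rV[R]_n, w1 x <= w2 x.
Proof.
have HC1 := HC2.1.
have [cw1 pw1 sub1 _] := sol1; have [cw2 pw2 _ super2] := sol2.
have pw : periodic (fun x => w1 x - w2 x) by move=> x i; rewrite pw1 pw2.
have [xM _ HM] := periodic_max (cont_sub cw1 cw2) pw.
pose M := w1 xM - w2 xM.
have [Q [Qint Qhol Qlag Qgap]] :=
  exists_dual_measure Hper HC1 HH1 HH2a cw1 pw1 sub1 cw2 pw2 super2 (erefl M).
have := hint _ (mather_torus_measure Hper HC1 HH1 HH2a Qint Qhol Qlag cw1 pw1 sub1).
rewrite (integral_torus_base HC1 Qint cw1 pw1) (integral_torus_base HC1 Qint cw2 pw2).
have i1 := Qint _ (cont_comp (@cont_fst R n) cw1).
have i2 := Qint _ (cont_comp (@cont_fst R n) cw2).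
have iM : Q.-integrable setT (cst M%:E) by exact: finite_measure_integrable_cst.
have Egap : (\int[Q]_z (gap w1 w2 M z)%:E =
    \int[Q]_z (w1 z.1)%:E - \int[Q]_z (w2 z.1)%:E - M%:E)%E.
  rewrite (_ : M%:E = \int[Q]_z (cst M%:E z))%E; last first.
    by rewrite integral_cst //= probability_setT mule1.
  rewrite -integralB // -integralB //; exact: integrableB.
have f1 := integrable_fin_num measurableT i1; have f2 := integrable_fin_num measurableT i2.
move: Qgap; rewrite Egap; move: f1 f2 => /=.
case: (\int[Q]_z (w1 z.1)%:E)%E => [a1| |] // _.
case: (\int[Q]_z (w2 z.1)%:E)%E => [a2| |] // _.
(* Both integrals being finite, 0 <= a1 - a2 - M together with a1 <= a2 forces M <= 0, and M bounds
   w1 - w2 everywhere. *)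
rewrite -!EFinB !lee_fin => h1 h2 x; have := HM x; rewrite -/M; lra.
Qed.
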